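(* Let $\lambda\in\mathbb{R}$, let $\vec v\in\mathbb{R}^3$ be a unit vector, and let $\Sigma$ be a $\lambda$-translating soliton of the Gauss curvature flow with respect to $\vec v$. If a principal curvature of $\Sigma$ is constant, then $\Sigma$ is one of the following surfaces: (1) a plane; (2) a cylindrical surface $C\times\mathbb{R}\vec v$, where $C\subset\mathbb{R}^3$ is a curve contained in a plane orthogonal to $\vec v$; (3) $K=0$, $0<|\lambda|<1$, and $\Sigma$ is a surface which makes a constant angle $\theta$ with $\vec v$, with $\cos\theta=|\lambda|$.
   Context: $\Sigma$ is an orientable surface immersed in Euclidean space $\mathbb{R}^3$, with unit normal $N$ (Gauss map). The principal curvatures $\kappa_1,\kappa_2$ are the eigenvalues of the shape operator $SX=-\overline\nabla_X N$ ($\overline\nabla$ the Levi-Civita connection of $\mathbb{R}^3$), and $K=\kappa_1\kappa_2$ is the Gauss curvature. ''A principal curvature is constant'' means that one of the two functions $\kappa_1,\kappa_2$ is constant on $\Sigma$. Given $\lambda\in\mathbb{R}$ and a unit vector $\vec v\in\mathbb{R}^3$, the surface $\Sigma$ is a $\lambda$-translating soliton of the Gauss curvature flow (with respect to $\vec v$) if $K=\langle N,\vec v\rangle+\lambda$ on $\Sigma$. The cylindrical surface $C\times\mathbb{R}\vec v$ is $\{c+t\vec v: c\in C,\ t\in\mathbb{R}\}$. A surface makes a constant angle $\theta$ with $\vec v$ if the angle between its unit normal (for a suitable choice of orientation) and $\vec v$ is constantly equal to $\theta$.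
   Formalization: Surfaces are taken connected and, as no completeness is assumed, ''is a plane'' and ''is a cylindrical surface'' mean an open part of one, with C a connected set swept out by regular smooth arcs; read literally the claim fails for an open disc in a plane parallel to v. *)

(* Defs.v *)
From HB Require Import structures.
From mathcomp Require Import all_boot all_order all_algebra.
From mathcomp Require Import all_classical all_reals all_analysis.

Set Implicit Arguments.
Unset Strict Implicit.
Unset Printing Implicit Defensive.

Import Order.TTheory GRing.Theory Num.Theory.
Import numFieldNormedType.Exports.

Local Open Scope classical_set_scope.
Local Open Scope ring_scope.

(* The library norm on 'rV[R]_n is the sup norm, so the Euclidean structure of
   R^n is spelled out here; the two norms induce the same topology. *)
Definition dotv (R : realType) (n : nat) (x y : 'rV[R]_n) : R :=
  \sum_(i < n) x 0 i * y 0 i.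

Definition enorm (R : realType) (n : nat) (x : 'rV[R]_n) : R :=
  Num.sqrt (dotv x x).

Definition angle (R : realType) (n : nat) (x y : 'rV[R]_n) : R :=
  acos (dotv x y / (enorm x * enorm y)).

Definition iter_derive (R : realType) (V W : normedModType R)
    (s : seq V) (f : V -> W) : V -> W :=
  foldr (fun w (g : V -> W) => 'D_w g) f s.

(* C^infinity on an open set U: every iterated directional derivative exists
   and is Frechet differentiable at every point of U. *)
Definition smooth_on (R : realType) (V W : normedModType R)
    (U : set V) (f : V -> W) : Prop :=
  forall (s : seq V) (x : V), U x -> differentiable (iter_derive s f) x.

(* Abstract connected smooth surface without boundary, given by an atlas.
   [param i] is the local parametrization defined on the open set [pdom i] and
   [coord i] its inverse; both are total functions whose values outside
   [pdom i], resp. outside its image, are irrelevant. *)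
Record smooth_surface (R : realType) := SmoothSurface {
  carrier :> topologicalType;
  surf_hausdorff : hausdorff_space carrier;
  surf_second_countable : @second_countable carrier;
  surf_connected : connected [set: carrier];
  chart : Type;
  pdom : chart -> set 'rV[R]_2;
  param : chart -> 'rV[R]_2 -> carrier;
  coord : chart -> carrier -> 'rV[R]_2;
  pdom_open : forall i, open (pdom i);
  image_open : forall i, open (param i @` pdom i);
  paramK : forall i u, pdom i u -> coord i (param i u) = u;
  param_continuous : forall i u, pdom i u -> {for u, continuous (param i)};
  coord_continuous : forall i u, pdom i u ->
    {for param i u, continuous (coord i)};
  chart_cover : forall p, exists i, (param i @` pdom i) p;
  transition_smooth : forall i j,
    smooth_on (pdom i `&` param i @^-1` (param j @` pdom j))
              (coord j \o param i)
}.

Section SurfacesInSpace.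
Variables (R : realType) (Sigma : smooth_surface R).
Implicit Types f N : Sigma -> 'rV[R]_3.

Definition smooth_map f : Prop :=
  forall i : chart Sigma, smooth_on (pdom i) (f \o param i).

Definition immersion f : Prop :=
  smooth_map f /\
  forall (i : chart Sigma) u, pdom i u -> injective ('d (f \o param i) u).

(* [N] is a global smooth unit normal field of the immersion [f]; its existence
   is the orientability of the surface. *)
Definition gauss_map f N : Prop :=
  [/\ smooth_map N,
      forall p, dotv (N p) (N p) = 1
    & forall (i : chart Sigma) u, pdom i u -> forall w : 'rV[R]_2,
        dotv (N (param i u)) ('d (f \o param i) u w) = 0].

(* [A] is the matrix (acting on row vectors) of the shape operator
   X |-> - dN(X) at [param i u], in the basis of the tangent plane formed by
   the coordinate vectors of the chart: - dN w = dx (w *m A). *)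
Definition shape_matrix f N (i : chart Sigma) (u : 'rV[R]_2) (A : 'M[R]_2) : Prop :=
  forall w : 'rV[R]_2,
    'd (f \o param i) u (w *m A) = - 'd (N \o param i) u w.

(* [k1 p], [k2 p] are the eigenvalues, with multiplicity, of the shape operator
   at [p].  No ordering of the two eigenvalues is prescribed. *)
Definition principal_curvatures f N (k1 k2 : Sigma -> R) : Prop :=
  forall (i : chart Sigma) u, pdom i u ->
    exists2 A : 'M[R]_2, shape_matrix f N i u A &
      char_poly A =
        ('X - (k1 (param i u))%:P) * ('X - (k2 (param i u))%:P).

Definition translating_soliton N (K : Sigma -> R) (lambda : R) (v : 'rV[R]_3) : Prop :=
  forall p, K p = dotv (N p) v + lambda.

Definition constant_function (k : Sigma -> R) : Prop :=
  exists c, forall p, k p = c.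

(* The surface need not be complete, so it is a plane, or a cylindrical
   surface, up to taking an open piece. *)
Definition is_planar f : Prop :=
  exists (o a : 'rV[R]_3) (O : set 'rV[R]_3),
    [/\ a != 0, open O & range f = [set x | dotv (x - o) a = 0] `&` O].

(* The piece over the arc c(]a, b[), with heights in ]l, r[, of the cylindrical
   surface with directrix [c] and rulings parallel to [v]. *)
Definition cylinder_piece (c : R -> 'rV[R]_3) (a b l r : R) (v : 'rV[R]_3) :
    set 'rV[R]_3 :=
  [set x | exists s t, [/\ a < s < b, l < t < r & x = c s + t *: v]].

(* The surface is an open piece of C x R v.  The curve [C] is the set of base
   points of the rulings met by the surface; it is connected and swept out by
   regular smooth arcs.  A global embedded directrix need not exist: an
   incomplete cylindrical surface may branch away from a common strip, over two
   arcs which agree to infinite order at the point where they separate. *)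
Definition is_cylindrical f (v : 'rV[R]_3) : Prop :=
  exists C : set 'rV[R]_3,
    [/\ connected C,
        exists d, forall x, C x -> dotv x v = d,
        forall p, exists x t, C x /\ f p = x + t *: v,
        forall x, C x -> exists p t, f p = x + t *: v
      & forall p : Sigma, exists (W : set Sigma) (c : R -> 'rV[R]_3) (a b l r : R),
          [/\ open W /\ W p,
              smooth_on (`]a, b[%classic : set R) c,
              forall s, a < s < b -> derive1 c s != 0 /\ C (c s)
            & f @` W = cylinder_piece c a b l r v]].

Definition constant_angle f (v : 'rV[R]_3) (theta : R) : Prop :=
  exists2 N, gauss_map f N & forall p, angle (N p) v = theta.

End SurfacesInSpace.

(* Main.v *)
(* Let k1 = c be the constant principal curvature and h = <N, v>, so that K = h + lambda.

   If c = 0, then h = - lambda is constant.  When |lambda| = 1 the normal is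
   constant and the surface is planar; when lambda = 0 the vector v is tangent and
   the surface is cylindrical; otherwise v makes a constant angle with N or - N.

   If c <> 0, consider the focal map y = x + N / c, whose differential has rank at
   most one.  Where dy <> 0, let w span the kernel of dy and let T = D_z y and
   S = D_z D_z y for a coordinate vector z.  Along w the direction of T is fixed
   and N rotates in the plane orthogonal to T, so the five functions h,
   <N x T, v>, <N, S>, det (N, S, T) and <T, T> satisfy a closed linear system.
   The soliton equation becomes a polynomial relation between them, and
   differentiating it along w yields enough relations to force h = 0 and
   lambda = 0.  The points where h = lambda = 0 form an open and closed set: either
   they exhaust the surface, and v is tangent everywhere, or dy vanishes
   identically, so that dN = - c dx with h constant, which is impossible.

   When v is tangent everywhere, project a neighbourhood of a point to the tangent
   plane.  This projection is a local homeomorphism, and along its level curves in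
   the direction v the component normal to the tangent plane at the base point is
   constant; the directrix is the projection of a straight segment of the chart,
   hence smooth without any implicit function theorem. *)
Require Import Defs.
From HB Require Import structures.
From mathcomp Require Import all_boot all_order all_algebra.
From mathcomp Require Import all_classical all_reals all_analysis.
From mathcomp Require Import ring lra.
Import Order.TTheory GRing.Theory Num.Theory.
Import numFieldNormedType.Exports.
Local Open Scope classical_set_scope.
Local Open Scope ring_scope.

Set Implicit Arguments.
Unset Strict Implicit.
Unset Printing Implicit Defensive.

(** * Mean value theorem and symmetry of second derivatives *)

Lemma close_to_common (R : realType) (a b d e : R) :
  `|a - d| < e / 2 -> `|b - d| < e / 2 -> `|a - b| <= e.
Proof.
move=> ad bd; rewrite (_ : a - b = a - d - (b - d)); last by ring.
by rewrite (le_trans (ler_normB _ _)) // [e in _ <= e]splitr lerD // ltW.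
Qed.

Section Lines.
Variables (R : realType) (V : normedModType R).
Implicit Types (x v w : V).

Lemma is_derive_line (W : normedModType R) (f : V -> W) x v (t : R) :
  derivable f (x + t *: v) v ->
  is_derive t 1 (fun s : R => f (x + s *: v)) ('D_v f (x + t *: v)).
Proof.
have E : (fun h : R => h^-1 *: (f (x + (h *: (1 : R) + t) *: v) - f (x + t *: v)))
       = (fun h => h^-1 *: (f (h *: v + (x + t *: v)) - f (x + t *: v))).
  apply/funext => h; congr (_ *: (f _ - _)).
  by rewrite [h *: 1](mulr1 h) scalerDl addrCA.
by move=> df; split; rewrite /derivable /derive /= E.
Qed.

Lemma derive_comp_shift (W : normedModType R) (f : V -> W) a x v :
  'D_v (f \o shift a) x = 'D_v f (x + a).
Proof.
have E : (fun h : R => h^-1 *: ((f \o shift a) (h *: v + x) - (f \o shift a) x))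
       = (fun h => h^-1 *: (f (h *: v + (x + a)) - f (x + a))).
  by apply/funext => h /=; rewrite addrA.
by rewrite /derive /= E.
Qed.

Lemma mvt_line (f : V -> R) x v :
  (forall t : R, 0 <= t <= 1 -> differentiable f (x + t *: v)) ->
  exists2 t : R, 0 < t < 1 & f (x + v) - f x = 'D_v f (x + t *: v).
Proof.
move=> df; pose g (t : R) := f (x + t *: v).
have dg (t : R) : 0 <= t <= 1 -> is_derive t 1 g ('D_v f (x + t *: v)).
  by move=> t01; apply: is_derive_line; apply/diff_derivable/df.
have [||t t01] := @MVT R g (fun t => 'D_v f (x + t *: v)) 0 1 ltr01.
- by move=> t; rewrite in_itv /= => /andP[t0 t1]; apply: dg; rewrite !ltW.
- apply: continuous_in_subspaceT => t; rewrite inE /= in_itv /= => t01.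
  have /dg[dgt _] := t01.
  exact/differentiable_continuous/derivable1_diffP.
rewrite /g subr0 mulr1 scale1r scale0r addr0 => E.
by exists t => //; move: t01; rewrite in_itv.
Qed.

Lemma derive_dirZ (W : normedModType R) (f : V -> W) (x v : V) (k : R) :
  differentiable f x -> 'D_(k *: v) f x = k *: 'D_v f x.
Proof. by move=> df; rewrite !deriveE // linearZ. Qed.

Lemma derive_dirD (W : normedModType R) (f : V -> W) x v w :
  differentiable f x -> 'D_(v + w) f x = 'D_v f x + 'D_w f x.
Proof. by move=> df; rewrite !deriveE // linearD. Qed.

(** Epsilon form of the definition: [diff_unique] identifies the candidate [L] with ['d f x], so
    differentiability can be transferred without knowing the differential beforehand. *)
Lemma littleo_differentiable (W : normedModType R) (f : V -> W)
    (L : {linear V -> W}) x : continuous L ->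
  (forall e : R, 0 < e -> \forall h \near (0 : V),
     `|f (h + x) - f x - L h| <= e * `|h|) ->
  differentiable f x.
Proof.
move=> cL H.
have E : f \o shift x = cst (f x) + L +o_ (0 : V) id.
  apply/eqaddoP => e e0; have := H _ e0; apply: filterS => h /=.
  by rewrite !fctE /= opprD addrA.
by apply/diff_locallyP; rewrite (diff_unique cL E).
Qed.

Lemma near_eq_differentiable (W : normedModType R) (f g : V -> W) x :
  (\near x, f x = g x) -> differentiable f x -> differentiable g x.
Proof.
move=> fg df; apply: (@littleo_differentiable _ g ('d f x)); first exact: diff_continuous.
move=> e e0; have /eqaddoP/(_ _ e0) := diff_locally df.
have fgx := nbhs_singleton fg.
have fg0 : \forall h \near (0 : V), f (h + x) = g (h + x).
  have cs : h + x @[h --> (0 : V)] --> x.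
    by rewrite -[X in _ --> X]add0r; apply: cvgD; [exact: cvg_id|exact: cvg_cst].
  exact: (cs _ fg).
by apply: filterS2 fg0 => h /= E; rewrite !fctE /= opprD addrA E fgx.
Qed.

Lemma mvt_lineZ (f : V -> R) x v (k : R) :
  (forall t : R, 0 <= t <= 1 -> differentiable f (x + t *: (k *: v))) ->
  exists2 t : R, 0 < t < 1 & f (x + k *: v) - f x = k * 'D_v f (x + t *: (k *: v)).
Proof.
move=> df; have [t t01 E] := mvt_line df; exists t => //; rewrite E derive_dirZ //.
by apply: df; case/andP: t01 => *; rewrite !ltW.
Qed.

(** The second difference over a parallelogram is the increment along [k *: v] of [G], itself the
    increment of [f] along [k *: w]. The mean value theorem is applied to [G], then to ['D_v f]. *)
Lemma iterated_difference (f : V -> R) (U : set V) v w x (k : R) :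
  (forall y, U y -> differentiable f y) ->
  (forall y, U y -> differentiable ('D_v f) y) ->
  (forall s t : R, 0 <= s <= 1 -> 0 <= t <= 1 ->
     U (x + s *: (k *: v) + t *: (k *: w))) ->
  exists s t : R, [/\ 0 <= s <= 1, 0 <= t <= 1 &
    f (x + k *: v + k *: w) - f (x + k *: v) - f (x + k *: w) + f x
    = k ^+ 2 * 'D_w ('D_v f) (x + s *: (k *: v) + t *: (k *: w))].
Proof.
move=> df ddf inU; pose G := (f \o shift (k *: w)) - f.
have U0 s : 0 <= s <= 1 -> U (x + s *: (k *: v)).
  by move=> s01; rewrite -[_ + _]addr0 -[0](scale0r (k *: w)); apply: inU; rewrite ?lexx ?ler01.
have U1 s : 0 <= s <= 1 -> U (x + s *: (k *: v) + k *: w).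
  by move=> s01; rewrite -[k *: w]scale1r; apply: inU; rewrite ?lexx ?ler01.
have dfS s : 0 <= s <= 1 -> differentiable (f \o shift (k *: w)) (x + s *: (k *: v)).
  move=> s01; apply: differentiable_comp; last exact/df/U1.
  by rewrite /shift; apply: differentiableD => //; apply: differentiable_cst.
have [s /andP[s0 s1] Es] : exists2 s : R, 0 < s < 1 &
    G (x + k *: v) - G x = k * 'D_v G (x + s *: (k *: v)).
  apply: mvt_lineZ => s s01; apply: differentiableB; first exact: dfS.
  exact/df/U0.
have s01 : 0 <= s <= 1 by rewrite !ltW.
have EG : 'D_v G (x + s *: (k *: v))
    = 'D_v f (x + s *: (k *: v) + k *: w) - 'D_v f (x + s *: (k *: v)).
  rewrite deriveB; [|exact/diff_derivable/dfS|exact/diff_derivable/df/U0].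
  by rewrite derive_comp_shift.
have [t /andP[t0 t1] Et] : exists2 t : R, 0 < t < 1 &
    'D_v f (x + s *: (k *: v) + k *: w) - 'D_v f (x + s *: (k *: v))
    = k * 'D_w ('D_v f) (x + s *: (k *: v) + t *: (k *: w)).
  by apply: mvt_lineZ => t t01; apply/ddf/inU.
exists s, t; rewrite s01 !ltW //; split=> //.
rewrite expr2 -mulrA -Et -EG -Es /G !fctE /=.
ring.
Qed.

(** The second difference is symmetric in [v] and [w], so on every small parallelogram the two mixed
    derivatives share a value, at possibly different points. Continuity at [x] then forces them to
    agree there. *)
Lemma derive_symmetric (U : set V) (f : V -> R) v w x : open U -> U x ->
  (forall y, U y -> differentiable f y) ->
  (forall y, U y -> differentiable ('D_v f) y) ->
  (forall y, U y -> differentiable ('D_w f) y) ->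
  {for x, continuous ('D_w ('D_v f))} -> {for x, continuous ('D_v ('D_w f))} ->
  'D_w ('D_v f) x = 'D_v ('D_w f) x.
Proof.
move=> oU Ux df dfv dfw c1 c2.
apply/eqP; rewrite -subr_eq0 -normr_le0; apply/ler_addgt0Pr => e e0; rewrite add0r.
have /nbhs_ballP[r /= r0 Br] : \forall y \near x, [/\ U y,
    `|'D_w ('D_v f) x - 'D_w ('D_v f) y| < e / 2 &
    `|'D_v ('D_w f) x - 'D_v ('D_w f) y| < e / 2].
  have e2 : 0 < e / 2 by rewrite divr_gt0.
  have Un : nbhs x U by apply: open_nbhs_nbhs.
  have N1 : \forall y \near x, `|'D_w ('D_v f) x - 'D_w ('D_v f) y| < e / 2.
    by have /cvgrPdist_lt/(_ _ e2) := c1.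
  have N2 : \forall y \near x, `|'D_v ('D_w f) x - 'D_v ('D_w f) y| < e / 2.
    by have /cvgrPdist_lt/(_ _ e2) := c2.
  by apply: filterS3 Un N1 N2 => y.
(* With this scale the whole parallelogram lies in the ball of radius [r]: [k] times the denominator
   is [r / 2], and the summand 1 keeps the denominator positive when [v] and [w] vanish. *)
have [k Ek] : exists k : R, k = r / (`|v| + `|w| + 1) / 2 by eexists.
have k0 : 0 < `|v| + `|w| + 1 by rewrite ltr_wpDl // addr_ge0.
have h0 : 0 < k by rewrite Ek !divr_gt0.
have kin v' w' s t : `|v'| + `|w'| = `|v| + `|w| -> 0 <= s <= 1 -> 0 <= t <= 1 ->
    ball x r (x + s *: (k *: v') + t *: (k *: w')).
  move=> E /andP[s0 s1] /andP[t0 t1].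
  rewrite -ball_normE /= -addrA opprD addNKr normrN.
  apply: (le_lt_trans (ler_normD _ _)).
  have kE : `|k| = k by apply: gtr0_norm.
  rewrite !normrZ kE (ger0_norm s0) (ger0_norm t0).
  apply: (@le_lt_trans _ _ (k * (`|v'| + `|w'|))).
    by rewrite mulrDr; apply: lerD; rewrite ler_piMl // mulr_ge0 // ltW.
  apply: (@lt_trans _ _ (k * (`|v| + `|w| + 1))).
    by rewrite E ltr_pM2l // ltrDl.
  rewrite Ek mulrAC divfK ?(gt_eqF k0) // ltr_pdivrMr //.
  by rewrite ltr_pMr // ltr1n.
have sub (P : V -> Prop) : (forall y, U y -> P y) -> forall y, ball x r y -> P y.
  by move=> UP y /Br[Uy _ _]; apply: UP.
have [s [t [s01 t01 E1]]] := iterated_difference (sub _ df) (sub _ dfv)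
  (fun s t => kin v w s t erefl).
have [s' [t' [s01' t01' E2]]] := iterated_difference (sub _ df) (sub _ dfw)
  (fun s t => kin w v s t (addrC _ _)).
have k2 : k ^+ 2 != 0 by rewrite expf_neq0 // gt_eqF.
have E : 'D_w ('D_v f) (x + s *: (k *: v) + t *: (k *: w))
    = 'D_v ('D_w f) (x + s' *: (k *: w) + t' *: (k *: v)).
  apply: (mulfI k2); apply: etrans (esym E1) (etrans _ E2).
  by rewrite (addrAC x (k *: w)); congr (_ + _); exact: addrAC.
have [_ L1 _] := Br _ (kin v w s t erefl s01 t01).
have [_ _ L2] := Br _ (kin w v s' t' (addrC _ _) s01' t01').
rewrite -E in L2.
exact: close_to_common L1 L2.
Qed.
End Lines.

(** * Perturbations of the identity *)

Section NearIdentity.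
Variables (R : realType) (n : nat).
Implicit Types (u v w z : 'rV[R]_n) (r e : R).

Lemma rV_norm_le m (x : 'rV[R]_m) e : 0 <= e ->
  (forall i, `|x 0 i| <= e) -> `|x| <= e.
Proof.
move=> e0 xe; rewrite [leLHS]/Num.norm /= mx_normrE.
by apply/bigmax_leP; split=> // -[i j] _ /=; rewrite ord1.
Qed.

Lemma rV_coord_le m (x : 'rV[R]_m) i : `|x 0 i| <= `|x|.
Proof.
rewrite [leRHS]/Num.norm /= mx_normrE.
exact: (le_bigmax _ (fun ij : 'I_1 * 'I_m => `|x ij.1 ij.2|) (0, i)).
Qed.

Lemma segment_closed_ball u v w (t r : R) : 0 <= t <= 1 ->
  `|w - u| <= r -> `|w - v| <= r -> `|w - (u + t *: (v - u))| <= r.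
Proof.
move=> /andP[t0 t1] ru rv.
have -> : w - (u + t *: (v - u)) = (1 - t) *: (w - u) + t *: (w - v).
  apply/rowP => i; rewrite !mxE; ring.
apply: (le_trans (ler_normD _ _)); rewrite !normrZ (ger0_norm t0) ger0_norm ?subr_ge0 //.
apply: (@le_trans _ _ ((1 - t) * r + t * r)); last by rewrite -mulrDl subrK mul1r.
by rewrite lerD // ler_wpM2l // subr_ge0.
Qed.

Lemma derive_rowE (W : normedModType R) (f : 'rV[R]_n -> W) u w :
  differentiable f u -> 'D_w f u = \sum_i w 0 i *: 'D_('e_i) f u.
Proof.
move=> df; rewrite deriveE // {1}[w]row_sum_delta linear_sum.
by apply: eq_bigr => i _; rewrite linearZ deriveE.
Qed.

(** Near [u0] the partial derivatives are small by continuity, and the mean value theorem on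
    segments, which stay in the ball, turns this into a Lipschitz bound. *)
Lemma near_lipschitz (f : 'rV[R]_n -> R) (U : set 'rV[R]_n) u0 e :
  open U -> U u0 -> (forall u, U u -> differentiable f u) ->
  (forall i, {for u0, continuous ('D_('e_i) f)}) ->
  (forall i, 'D_('e_i) f u0 = 0) -> 0 < e ->
  \forall r \near 0^'+, forall u v, `|u0 - u| <= r -> `|u0 - v| <= r ->
    `|f u - f v| <= e * `|u - v|.
Proof.
move=> oU Uu0 df cf f0 e0.
(* Each of the [n] partial derivatives gets this share of [e]; the successor avoids dividing by zero
   when [n] is 0. *)
have e1 : 0 < e / n.+1%:R by rewrite divr_gt0 // ltr0n.
have : \forall u \near u0, U u /\ forall i, `|'D_('e_i) f u| < e / n.+1%:R.
  apply: filterI; first by apply: open_nbhs_nbhs.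
  apply: (@filter_forall _ _ (fun i u => is_true (`|'D_('e_i) f u| < e / n.+1%:R)) (nbhs u0) _).
  move=> i; have /cvgrPdist_lt/(_ _ e1) := cf i.
  by apply: filterS => u; rewrite f0 sub0r normrN.
move=> /nbhs_normP[r0 /= r00 B]; near=> r => u v ur vr.
have [t|t t01 E] := @mvt_line _ _ f v (u - v).
  by move=> t01; apply: df; apply: (B _ _).1 => /=;
    apply: (@le_lt_trans _ _ r); [exact: segment_closed_ball|near: r; exact: nbhs_right_lt].
have t01' : 0 <= t <= 1 by case/andP: t01 => *; rewrite !ltW.
have [Ux Dx] : U (v + t *: (u - v)) /\
    forall i, `|'D_('e_i) f (v + t *: (u - v))| < e / n.+1%:R.
  apply: B => /=; apply: (@le_lt_trans _ _ r); first exact: segment_closed_ball.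
  by near: r; exact: nbhs_right_lt.
rewrite -[u in f u](subrKC v) E derive_rowE; last exact: df.
apply: (le_trans (ler_norm_sum _ _ _)).
apply: (@le_trans _ _ (\sum_(i < n) `|u - v| * (e / n.+1%:R))).
  apply: ler_sum => i _; rewrite normrM ler_pM //; first exact: rV_coord_le.
  exact/ltW.
rewrite sumr_const card_ord -mulrnAr mulrC ler_wpM2r // -mulr_natr -mulrA ler_piMr //.
  exact: ltW.
by rewrite ler_pdivrMl ?ltr0n // mulr1 ler_nat.
Unshelve. all: by end_near. Qed.

(** The remainder [f i - L i] has vanishing derivative at [u0], so [near_lipschitz] applies to it;
    finitely many components allow a common radius. *)
Lemma near_identity m (f : 'I_m -> 'rV[R]_n -> R) (L : 'I_m -> {linear 'rV[R]_n -> R})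
    (U : set 'rV[R]_n) u0 e :
  open U -> U u0 -> (forall i u, U u -> differentiable (f i) u) ->
  (forall i j, {for u0, continuous ('D_('e_j) (f i))}) ->
  (forall i, continuous (L i)) ->
  (forall i w, 'D_w (f i) u0 = L i w) -> 0 < e ->
  \forall r \near 0^'+, (forall u, `|u0 - u| <= r -> U u) /\
    forall i u v, `|u0 - u| <= r -> `|u0 - v| <= r ->
    `|f i u - f i v - L i (u - v)| <= e * `|u - v|.
Proof.
move=> oU Uu0 df cf cL fL e0; apply: filterI.
  have /nbhs_normP[r0 /= r00 B] : nbhs u0 U by apply: open_nbhs_nbhs.
  near=> r => u ur; apply: B => /=; apply: (le_lt_trans ur).
  by near: r; exact: nbhs_right_lt.
apply: (@filter_forall _ _ (fun i r => forall u v, `|u0 - u| <= r -> `|u0 - v| <= r ->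
  `|f i u - f i v - L i (u - v)| <= e * `|u - v|) (0^'+) _) => i; pose g := f i - (L i : _ -> _).
have dL u : differentiable (L i) u by apply/linear_differentiable/cL.
have dg u : U u -> differentiable g u.
  by move=> Uu; apply: differentiableB => //; exact: df.
have Dg w u : U u -> 'D_w g u = 'D_w (f i) u - L i w.
  move=> Uu; rewrite /g deriveB; [|exact/diff_derivable/df|exact/diff_derivable].
  by rewrite [in 'D_w (L i) u]deriveE // diff_lin.
have : \forall r \near 0^'+, forall u v, `|u0 - u| <= r -> `|u0 - v| <= r ->
    `|g u - g v| <= e * `|u - v|.
  apply: (@near_lipschitz g U) => // j; last by rewrite Dg // fL subrr.
  have : ('D_('e_j) (f i) x - L i ('e_j)) @[x --> u0] --> 'D_('e_j) g u0.
    have C : 'D_('e_j) (f i) x @[x --> u0] --> 'D_('e_j) (f i) u0 by exact: cf.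
    by rewrite Dg //; apply: cvgB C _; exact: cvg_cst.
  have Un : nbhs u0 U by apply: open_nbhs_nbhs.
  have E : \forall u \near u0, 'D_('e_j) (f i) u - L i 'e_j = 'D_('e_j) g u.
    by apply: filterS Un => u Uu; rewrite Dg.
  exact: cvg_trans (near_eq_cvg E).
apply: filterS => r H u v ur vr; have := H u v ur vr.
have gE x : g x = f i x - L i x by [].
rewrite !gE [L i (u - v)]linearB.
by have -> : f i u - L i u - (f i v - L i v) = f i u - f i v - (L i u - L i v) by ring.
Unshelve. all: by end_near. Qed.

(* A minimizer of |g u - z| on the closed ball must solve g u = z: the Newton
   step u - (g u - z) stays in the ball and halves the distance to z. *)
Lemma near_identity_surj (g : 'rV[R]_n -> 'rV[R]_n) u0 r z : 0 < r ->
  (forall u, `|u0 - u| <= r -> {for u, continuous g}) ->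
  (forall u v, `|u0 - u| <= r -> `|u0 - v| <= r ->
     `|g u - g v - (u - v)| <= 2^-1 * `|u - v|) ->
  `|g u0 - z| <= r / 2 -> exists2 u, `|u0 - u| <= r & g u = z.
Proof.
move=> r0 cg H zr; pose A : set 'rV[R]_n := closed_ball u0 r.
have AE u : A u <-> `|u0 - u| <= r by rewrite /A closed_ballE.
have cA : compact A.
  apply: bounded_closed_compact; last exact: closed_ball_closed.
  exists (`|u0| + r); split=> [|M ltM u /= /AE ur]; first exact: num_real.
  rewrite -[u](subKr u0) (le_trans (ler_normB _ _)) // (le_trans _ (ltW ltM)) //.
  by rewrite lerD2l.
have [||u uA umin] := @EVT_min_rV R n (fun u => `|g u - z|) A _ cA.
- by exists u0; apply/AE; rewrite subrr normr0 ltW.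
- apply: continuous_in_subspaceT => u /set_mem/AE ur.
  apply: (@continuous_comp _ _ _ (fun u => g u - z) (@Num.norm _ _)); last exact: norm_continuous.
  by apply: continuousB; [exact: cg|exact: cst_continuous].
move: uA => /set_mem/AE ur; exists u => //; apply/eqP; rewrite -subr_eq0 -normr_eq0.
pose v := u - (g u - z).
have vr : `|u0 - v| <= r.
  have u0r : `|u0 - u0| <= r by rewrite subrr normr0 ltW.
  have -> : u0 - v = (g u - g u0 - (u - u0)) + (g u0 - z).
    by rewrite /v; apply/rowP => i; rewrite !mxE; ring.
  rewrite (le_trans (ler_normD _ _)) // [r in _ <= r]splitr lerD //.
  by rewrite (le_trans (H _ _ ur u0r)) // mulrC ler_wpM2r // ?invr_ge0 // distrC.
have := umin v (mem_set (iffRL (AE v) vr)).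
have -> : g v - z = g v - g u - (v - u).
  by rewrite /v; apply/rowP => i; rewrite !mxE; ring.
move=> /le_trans/(_ (H _ _ vr ur)).
have -> : v - u = - (g u - z) by rewrite /v addrAC subrr sub0r.
by rewrite normrN => h; rewrite eq_le normr_ge0 andbT; lra.
Qed.

End NearIdentity.

(** * Smooth functions *)

Section Smooth.
Variable R : realType.
Implicit Types V W : normedModType R.

Lemma smooth_on_differentiable V W (U : set V) (f : V -> W) x :
  smooth_on U f -> U x -> differentiable f x.
Proof. by move=> /(_ [::]); apply. Qed.

Lemma smooth_on_derive V W (U : set V) (f : V -> W) w :
  smooth_on U f -> smooth_on U ('D_w f).
Proof. by move=> sf s x Ux; have := sf (rcons s w) x Ux; rewrite /iter_derive foldr_rcons. Qed.

Lemma smooth_on_derive_continuous V W (U : set V) (f : V -> W) w x :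
  smooth_on U f -> U x -> {for x, continuous ('D_w f)}.
Proof.
move=> /(@smooth_on_derive _ _ _ _ w)/smooth_on_differentiable sf /sf.
exact: differentiable_continuous.
Qed.

(** Closure principle behind the smoothness lemmas below: it suffices to find a class of functions
    differentiable on [U] and stable under directional derivatives. Stability is only asked up to
    equality on [U], since on an open set this is equality of germs. *)
Lemma smooth_on_class V W (U : set V) (P : (V -> W) -> Prop) : open U ->
  (forall f x, P f -> U x -> differentiable f x) ->
  (forall f w, P f -> exists2 g, P g & forall x, U x -> 'D_w f x = g x) ->
  forall f, P f -> smooth_on U f.
Proof.
move=> oU dP DP f Pf s.
have near_on g h x : (forall x, U x -> g x = h x :> W) -> U x ->
    \forall x \near x, h x = g x.
  move=> gh Ux; have Un : nbhs x U by apply: open_nbhs_nbhs.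
  by apply: filterS Un => y /gh.
have [g Pg Eg] : exists2 g, P g & forall x, U x -> iter_derive s f x = g x.
  elim: s => [|w s [g Pg Eg]] /=; first by exists f.
  have [g' Pg' Eg'] := DP g w Pg; exists g' => // x Ux.
  by rewrite -Eg' //; apply/esym/near_eq_derive/near_on.
by move=> x Ux; apply: near_eq_differentiable (dP g x Pg Ux); exact: near_on.
Qed.

Lemma smooth_on_linear V W W' (U : set V) (f : V -> W) (L : {linear W -> W'}) :
  continuous L -> open U -> smooth_on U f -> smooth_on U (L \o f).
Proof.
move=> cL oU sf; pose P (h : V -> W') := exists2 f, smooth_on U f & h = L \o f.
have dL y : differentiable L y by apply/linear_differentiable/cL.
apply: (@smooth_on_class _ _ U P) => //; last by exists f.
  move=> _ x [g sg ->] Ux; apply: differentiable_comp => //.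
  exact: smooth_on_differentiable Ux.
move=> _ w [g sg ->]; exists (L \o 'D_w g).
  by exists ('D_w g) => //; exact: smooth_on_derive.
move=> x Ux; have dg := smooth_on_differentiable sg Ux.
rewrite deriveE; last exact: differentiable_comp.
by rewrite diff_comp // /= diff_lin //= deriveE.
Qed.

Lemma differentiable_affine V V' W (f : V -> W) (L : {linear V' -> V}) a x :
  continuous L -> differentiable f (a + L x) -> differentiable (fun x => f (a + L x)) x.
Proof.
move=> cL df; apply: (@differentiable_comp _ _ _ _ (fun x => a + L x) f) => //.
by apply: differentiableD; [exact: differentiable_cst|exact/linear_differentiable/cL].
Qed.

Lemma derive_affine V V' W (f : V -> W) (L : {linear V' -> V}) a x w :
  continuous L -> differentiable f (a + L x) ->
  'D_w (fun x => f (a + L x)) x = 'D_(L w) f (a + L x).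
Proof.
move=> cL df; have dL : differentiable L x by exact/linear_differentiable/cL.
have da : differentiable (fun x => a + L x) x by apply: differentiableD.
rewrite deriveE; last exact: differentiable_affine.
apply: etrans (congr1 (fun h : V' -> W => h w) (diff_comp da df)) _.
have Ew : 'd (fun x => a + L x) x w = L w.
  apply: etrans (congr1 (fun h : V' -> V => h w) (diffD (differentiable_cst a x) dL)) _.
  by rewrite diff_cst diff_lin // -[LHS]/(0 + L w) add0r.
by rewrite deriveE //; exact: (congr1 ('d f (a + L x)) Ew).
Qed.

Lemma smooth_on_affine V V' W (U : set V) (f : V -> W) (L : {linear V' -> V}) a :
  continuous L -> open U -> smooth_on U f ->
  smooth_on [set x | U (a + L x)] (fun x => f (a + L x)).
Proof.
move=> cL oU sf; pose P (h : V' -> W) := exists2 f, smooth_on U f & h = fun x => f (a + L x).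
have ca : continuous (fun x => a + L x).
  by move=> x; apply: cvgD; [exact: cvg_cst|exact: cL].
apply: (@smooth_on_class _ _ _ P) => //; last by exists f.
- by apply: open_comp => // x _; exact: ca.
- move=> _ x [g sg ->] Ux; apply: differentiable_affine => //.
  exact: smooth_on_differentiable sg Ux.
- move=> _ w [g sg ->]; exists (fun x => 'D_(L w) g (a + L x)).
    by exists ('D_(L w) g) => //; exact: smooth_on_derive.
  by move=> x Ux; apply: derive_affine => //; exact: smooth_on_differentiable sg Ux.
Qed.

Lemma smooth_on_line V W (U : set V) (f : V -> W) a v : open U -> smooth_on U f ->
  smooth_on [set t : R | U (a + t *: v)] (fun t : R => f (a + t *: v)).
Proof.
move=> oU sf; pose P (h : R -> W) := exists2 f, smooth_on U f & h = fun t => f (a + t *: v).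
have ca : continuous (fun t : R => a + t *: v).
  by move=> t; apply: cvgD; [exact: cvg_cst|exact: scalel_continuous].
have dl (g : V -> W) t : smooth_on U g -> U (a + t *: v) ->
    is_derive t 1 (fun t : R => g (a + t *: v)) ('D_v g (a + t *: v)).
  move=> sg Ut; apply: is_derive_line.
  exact/diff_derivable/(smooth_on_differentiable sg Ut).
apply: (@smooth_on_class _ _ _ P) => //; last by exists f.
- by apply: open_comp => // t _; exact: ca.
- by move=> _ t [g sg ->] Ut; have [/derivable1_diffP] := dl g t sg Ut.
- move=> _ w [g sg ->]; exists (fun t => 'D_(w *: v) g (a + t *: v)).
    by exists ('D_(w *: v) g) => //; exact: smooth_on_derive.
  move=> t Ut; have [/derivable1_diffP dg Dg] := dl g t sg Ut.
  have : 'D_(w *: (1 : R)) (fun t : R => g (a + t *: v)) t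
      = w *: 'D_1 (fun t : R => g (a + t *: v)) t by exact: derive_dirZ.
  rewrite [w *: 1]mulr1 => ->; rewrite Dg derive_dirZ //.
  exact: smooth_on_differentiable sg Ut.
Qed.

Lemma smooth_onDZ V W (U : set V) (f g : V -> W) (k : R) : open U ->
  smooth_on U f -> smooth_on U g -> smooth_on U (f + k *: g).
Proof.
move=> oU sf sg.
pose P (h : V -> W) := exists f g, [/\ smooth_on U f, smooth_on U g & h = f + k *: g].
apply: (@smooth_on_class _ _ U P) => //; last by exists f, g.
  move=> _ x [{sf}f [{sg}g [sf sg ->]]] Ux; apply: differentiableD.
    exact: smooth_on_differentiable Ux.
  exact/differentiableZ/(smooth_on_differentiable sg Ux).
move=> _ w [{sf}f [{sg}g [sf sg ->]]]; exists ('D_w f + k *: 'D_w g).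
  by exists ('D_w f), ('D_w g); split=> //; exact: smooth_on_derive.
move=> x Ux; have df := smooth_on_differentiable sf Ux.
have dg := smooth_on_differentiable sg Ux.
have dgw : derivable g x w by exact: diff_derivable.
by rewrite deriveD ?deriveZ //; [exact: diff_derivable|exact: derivableZ].
Qed.

Lemma smooth_on_symmetric V (U : set V) (f : V -> R) v w x : open U ->
  smooth_on U f -> U x -> 'D_w ('D_v f) x = 'D_v ('D_w f) x.
Proof.
move=> oU sf Ux; apply: (@derive_symmetric _ _ U) => //.
- by move=> y; exact: smooth_on_differentiable.
- by move=> y; apply/smooth_on_differentiable/smooth_on_derive.
- by move=> y; apply/smooth_on_differentiable/smooth_on_derive.
- by apply: smooth_on_derive_continuous Ux; exact: smooth_on_derive.
- by apply: smooth_on_derive_continuous Ux; exact: smooth_on_derive.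
Qed.

Lemma derive_eq_on V W (U : set V) (f g : V -> W) w x : open U -> U x ->
  (forall x, U x -> f x = g x) -> 'D_w f x = 'D_w g x.
Proof.
move=> oU Ux fg; apply: near_eq_derive.
have Un : nbhs x U by apply: open_nbhs_nbhs.
by apply: filterS Un => y /fg.
Qed.

End Smooth.

(** * The polynomial system along the kernel of the focal map *)

(** These rules give the derivative values as plain ring expressions. [derive_polynomial] chains
    them along the syntax of a function and leaves a polynomial in the known derivatives. *)
Lemma is_derive_add (R : realType) (V : normedModType R) (f g : V -> R) u w (a b : R) :
  is_derive u w f a -> is_derive u w g b -> is_derive u w (f + g) (a + b).
Proof. by move=> df dg; exact: is_deriveD. Qed.

Lemma is_derive_mul (R : realType) (V : normedModType R) (f g : V -> R) u w (a b : R) :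
  is_derive u w f a -> is_derive u w g b -> is_derive u w (f * g) (f u * b + g u * a).
Proof. by move=> df dg; exact: is_deriveM. Qed.

Lemma is_derive_opp (R : realType) (V : normedModType R) (f : V -> R) u w (a : R) :
  is_derive u w f a -> is_derive u w (- f) (- a).
Proof. by move=> df; exact: is_deriveN. Qed.

Ltac derive_polynomial :=
  lazymatch goal with
  | |- is_derive _ _ (cst _) _ => exact: is_derive_cst
  | |- is_derive _ _ (_ + _) _ => eapply is_derive_add; derive_polynomial
  | |- is_derive _ _ (- _) _ => eapply is_derive_opp; derive_polynomial
  | |- is_derive _ _ (_ * _) _ => eapply is_derive_mul; derive_polynomial
  | |- _ => eassumption
  end.

Section FocalSystem.
Variables (R : realType) (V : normedModType R) (U : set V).
Hypothesis oU : open U.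

Lemma is_derive_eq0 (f : V -> R) u w d :
  (forall u, U u -> f u = 0) -> U u -> is_derive u w f d -> d = 0.
Proof.
move=> f0 Uu [_ <-].
by rewrite (@derive_eq_on _ _ _ U f (cst 0)) // derive_cst.
Qed.

(** With T the derivative of the focal map along a coordinate vector and S the next derivative of T,
    these stand for [h] = <N, v>, [m] = <N x T, v>, [p] = <N, S>, [e] = det(N, S, T) and [Q] = <T,
    T>; [b] will be [c ^+ 2 - lambda]. *)
Variables (h m p e Q : V -> R) (b c : R).
Hypothesis c_neq0 : c != 0.
Hypothesis Q_gt0 : forall u, U u -> 0 < Q u.
Hypothesis differentiable_hmpeQ : forall u, U u ->
  [/\ differentiable h u, differentiable m u, differentiable p u,
      differentiable e u & differentiable Q u].
Hypothesis along : forall u, U u -> exists w (alpha beta : R), alpha != 0 /\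
  [/\ 'D_w h u = alpha * m u,
      'D_w m u = beta * m u - alpha * Q u * h u,
      'D_w p u = 2 * beta * p u - alpha * e u,
      'D_w e u = alpha * Q u * p u + 3 * beta * e u &
      'D_w Q u = 2 * beta * Q u].
Hypothesis rel0 : forall u, U u ->
  (p u + c * Q u) * (h u - b) + c ^+ 3 * Q u = 0.

(* Each relation is homogeneous when m, p, e, Q have weights 1, 2, 3, 2, and
   differentiating it along w produces the next one; four steps suffice. *)
Lemma focal_system : forall u, U u -> h u = 0 /\ b = c ^+ 2.
Proof.
pose r0 := (p + cst c * Q) * (h - cst b) + cst (c ^+ 3) * Q.
pose r1 := e * (h - cst b) - (p + cst c * Q) * m.
pose r2 := cst 2 * e * m + Q * (p + cst c * Q) * h + Q * p * (h - cst b).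
pose r3 := p * m - e * h.
(* One differentiation step: if the derivative of [r] along [w] yields [al * s], then [s] vanishes
   too, because [al] is nonzero. A relation of weight k reproduces itself with factor [k * be], and
   that multiple is removed in each use. *)
have step (r s : V -> R) : (forall u, U u -> r u = 0) ->
    (forall u w al be, U u -> al != 0 -> is_derive u w h (al * m u) ->
      is_derive u w m (be * m u - al * Q u * h u) ->
      is_derive u w p (2 * be * p u - al * e u) ->
      is_derive u w e (al * Q u * p u + 3 * be * e u) ->
      is_derive u w Q (2 * be * Q u) ->
      exists2 d, is_derive u w r d & d = 0 -> al * s u = 0) ->
    forall u, U u -> s u = 0.
  move=> r_eq0 H u Uu; have [w [al [be [al0 [Dh Dm Dp De DQ]]]]] := along Uu.
  have [dh dm dp de dQ] := differentiable_hmpeQ Uu.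
  have [|||||d D E] := H u w al be Uu al0; try by split=> //; exact: diff_derivable.
  by have /eqP := E (is_derive_eq0 r_eq0 Uu D); rewrite mulf_eq0 (negPf al0) => /eqP.
have R0 u : U u -> r0 u = 0 by move=> Uu; exact: rel0.
have R1 : forall u, U u -> r1 u = 0.
  apply: (step _ _ R0) => u w al be Uu al0 Dh Dm Dp De DQ.
  eexists; first (rewrite /r0; derive_polynomial).
  have := congr1 ( *%R (2 * be)) (R0 u Uu).
  rewrite /r0 /r1 !fctE /= => E0 E.
  lra.
have R2 : forall u, U u -> r2 u = 0.
  apply: (step _ _ R1) => u w al be Uu al0 Dh Dm Dp De DQ.
  eexists; first (rewrite /r1; derive_polynomial).
  have := congr1 ( *%R (3 * be)) (R1 u Uu).
  rewrite /r1 /r2 !fctE /= => E0 E.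
  lra.
(* Once the multiples of [r2] and [r1] are removed, the derivative of [r2] is [3 * al * Q * r3]; the
   positive factor [Q] is cancelled. *)
have R3 : forall u, U u -> r3 u = 0.
  apply: (step _ _ R2) => u w al be Uu al0 Dh Dm Dp De DQ.
  eexists; first (rewrite /r2; derive_polynomial).
  have := congr1 ( *%R (4 * be)) (R2 u Uu).
  have := congr1 ( *%R (al * Q u)) (R1 u Uu).
  rewrite /r1 /r2 /r3 !fctE /= => E1 E0 E.
  apply: (mulfI (lt0r_neq0 (Q_gt0 Uu))).
  lra.
have R4 : forall u, U u -> (e * m + Q * p * h) u = 0.
  apply: (step _ _ R3) => u w al be Uu al0 Dh Dm Dp De DQ.
  eexists; first (rewrite /r3; derive_polynomial).
  have := congr1 ( *%R (3 * be)) (R3 u Uu).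
  rewrite /r3 !fctE /= => E0 E.
  lra.
move=> u Uu; have {}R0 := rel0 Uu; have Qu := Q_gt0 Uu.
have {}R1 : e u * (h u - b) - (p u + c * Q u) * m u = 0 := R1 u Uu.
have {}R2 : 2 * e u * m u + Q u * (p u + c * Q u) * h u + Q u * p u * (h u - b) = 0 := R2 u Uu.
have {}R3 : p u * m u - e u * h u = 0 := R3 u Uu.
have {}R4 : e u * m u + Q u * p u * h u = 0 := R4 u Uu.
have Q0 := lt0r_neq0 Qu.
have Qp : 0 <= Q u * p u ^+ 2 by apply: mulr_ge0; [exact: ltW|exact: sqr_ge0].
(* [R3] and [R4] are linear and homogeneous in [m] and [h], with determinant [e ^+ 2 + Q * p ^+ 2].
   If it vanishes, then [e] and [p] vanish, and [R2] and [R1] reduce to nonzero multiples of [h] and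
   [m]. *)
have hm0 : h u = 0 /\ m u = 0.
  have Em : (e u ^+ 2 + Q u * p u ^+ 2) * m u = 0.
    have := congr1 ( *%R (e u)) R4; have := congr1 ( *%R (Q u * p u)) R3; lra.
  have Eh : (e u ^+ 2 + Q u * p u ^+ 2) * h u = 0.
    have := congr1 ( *%R (p u)) R4; have := congr1 ( *%R (e u)) R3; lra.
  have [S|S] := eqVneq (e u ^+ 2 + Q u * p u ^+ 2) 0; last first.
    by move/eqP: Em; move/eqP: Eh; rewrite !mulf_eq0 (negPf S) /= => /eqP-> /eqP->.
  move/eqP: S; rewrite paddr_eq0 ?sqr_ge0 //.
  rewrite sqrf_eq0 mulf_eq0 sqrf_eq0 (negPf Q0) /= => /andP[/eqP e0 /eqP p0].
  have cQ0 : c * Q u != 0 by rewrite mulf_neq0.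
  split; [apply: (mulfI cQ0); apply: (mulfI Q0)|apply: (mulfI cQ0)].
    by move: R2; rewrite e0 p0; lra.
  by move: R1; rewrite e0 p0; lra.
case: hm0 => h0 m0; split=> //.
(* With [h] and [m] zero, [R2] says that [p * b] vanishes, so [R0] reduces to
   [c * Q * (c ^+ 2 - b) = 0]. *)
have pb : p u * b = 0 by apply: (mulfI Q0); move: R2; rewrite h0 m0; lra.
apply: (mulfI c_neq0); apply: (mulfI Q0).
by move: R0; rewrite h0; lra.
Qed.
End FocalSystem.

(** * Derivatives of a map of rank one *)

(** The last hypothesis is the rank-one relation [P * y2 = Q * y1] differentiated once along z,
    where [y1] and [y2] are derivatives along z and z'; it is solved for the mixed derivative. *)
Lemma rank_one_first (F : fieldType) (P Q DP DQ y1 y2 y11 y12 : F) : P != 0 ->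
  y2 = Q / P * y1 -> (P * y12 + y2 * DP) + - (Q * y11 + y1 * DQ) = 0 ->
  y12 = (Q * y11 + (DQ - DP * Q / P) * y1) / P.
Proof.
move=> P0 -> E; apply: (mulfI P0); apply/eqP; rewrite -subr_eq0; apply/eqP.
by rewrite -[RHS]E; field.
Qed.

(** The same relation differentiated twice along z, with the lower mixed derivatives eliminated; the
    left side is the derivative of [y11] along the kernel direction. *)
Lemma rank_one_second (F : fieldType) (P Q DP DQ D2P D2Q b y1 y2 y11 y12 y112 y111 : F) :
  P != 0 -> y2 = Q / P * y1 -> y12 = (Q * y11 + b * y1) / P ->
  (P * y112 + y12 * DP + (y2 * D2P + DP * y12))
    + - ((Q * y111 + y11 * DQ) + (y1 * D2Q + DQ * y11)) = 0 ->
  P * y112 - Q * y111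
  = (D2Q - D2P * Q / P - 2 * DP * b / P) * y1 + 2 * (DQ - DP * Q / P) * y11.
Proof.
move=> P0 -> -> E; apply/eqP; rewrite -subr_eq0; apply/eqP.
by rewrite -[RHS]E; field.
Qed.

Section RankOne.
Variables (R : realType) (V : normedModType R) (U : set V).
Hypothesis oU : open U.
Variables (I : Type) (F : I -> V -> R) (k : I) (z z' : V).
Hypothesis sF : forall j, smooth_on U (F j).
Hypothesis Fk_neq0 : forall u, U u -> 'D_z (F k) u != 0.
Hypothesis rank1 : forall j u, U u ->
  'D_z (F k) u * 'D_z' (F j) u = 'D_z' (F k) u * 'D_z (F j) u.

(* The direction w spans the kernel of dF. *)
Lemma rank_one_along u : U u -> exists beta gamma : R,
  forall j, let w := 'D_z (F k) u *: z' - 'D_z' (F k) u *: z in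
  [/\ 'D_w (F j) u = 0, 'D_w ('D_z (F j)) u = beta * 'D_z (F j) u &
      'D_w ('D_z ('D_z (F j))) u
      = gamma * 'D_z (F j) u + 2 * beta * 'D_z ('D_z (F j)) u].
Proof.
move=> Uu.
have dir (G : V -> R) : differentiable G u ->
    'D_('D_z (F k) u *: z' - 'D_z' (F k) u *: z) G u
    = 'D_z (F k) u * 'D_z' G u - 'D_z' (F k) u * 'D_z G u.
  by move=> dG; rewrite -scaleNr derive_dirD // !derive_dirZ // scaleNr.
have der (G : V -> R) w v : smooth_on U G -> U v -> is_derive v w G ('D_w G v).
  by move=> sG Uv; split=> //; apply/diff_derivable/(smooth_on_differentiable sG).
have sD w (G : V -> R) : smooth_on U G -> smooth_on U ('D_w G).
  exact: smooth_on_derive.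
pose P : V -> R := 'D_z (F k); pose Q : V -> R := 'D_z' (F k).
have sP : smooth_on U P by exact/sD. have sQ : smooth_on U Q by exact/sD.
pose DF w j : V -> R := 'D_w (F j); pose DDF w w' j : V -> R := 'D_w (DF w' j).
pose G j : V -> R := P * DF z' j + - (Q * DF z j).
pose DP : V -> R := 'D_z P; pose DQ : V -> R := 'D_z Q.
pose G1 j : V -> R := (P * DDF z z' j + DF z' j * DP) + - (Q * DDF z z j + DF z j * DQ).
have G_0 j v : U v -> G j v = 0.
  move=> Uv; have := rank1 j Uv => E.
  by apply: (etrans (_ : _ = P v * _ - Q v * _)) _ => //; rewrite /P /Q E subrr.
have sDF w j : smooth_on U (DF w j) by exact: sD.
have G1_0 j v : U v -> G1 j v = 0.
  move=> Uv.
  have d1 : is_derive v z (DF z' j) (DDF z z' j v) by exact: der.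
  have d2 : is_derive v z (DF z j) (DDF z z j v) by exact: der.
  have d3 : is_derive v z P (DP v) by exact: der.
  have d4 : is_derive v z Q (DQ v) by exact: der.
  exact: (is_derive_eq0 oU (G_0 j) Uv
    (is_derive_add (is_derive_mul d3 d1) (is_derive_opp (is_derive_mul d4 d2)))).
have G2_0 j : (P u * 'D_z (DDF z z' j) u + DDF z z' j u * DP u
    + (DF z' j u * 'D_z DP u + DP u * DDF z z' j u))
  + - ((Q u * 'D_z (DDF z z j) u + DDF z z j u * DQ u)
    + (DF z j u * 'D_z DQ u + DQ u * DDF z z j u)) = 0.
  have d1 : is_derive u z (DF z' j) (DDF z z' j u) by exact: der.
  have d2 : is_derive u z (DF z j) (DDF z z j u) by exact: der.
  have d3 : is_derive u z P (DP u) by exact: der.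
  have d4 : is_derive u z Q (DQ u) by exact: der.
  have d5 : is_derive u z (DDF z z' j) ('D_z (DDF z z' j) u) by apply: der => //; exact: sD.
  have d6 : is_derive u z (DDF z z j) ('D_z (DDF z z j) u) by apply: der => //; exact: sD.
  have d7 : is_derive u z DP ('D_z DP u) by apply: der => //; exact: sD.
  have d8 : is_derive u z DQ ('D_z DQ u) by apply: der => //; exact: sD.
  exact: (is_derive_eq0 oU (G1_0 j) Uu (is_derive_add
    (is_derive_add (is_derive_mul d3 d5) (is_derive_mul d1 d7))
    (is_derive_opp (is_derive_add (is_derive_mul d4 d6) (is_derive_mul d2 d8))))).
have P0 : P u != 0 by exact: Fk_neq0.
(* This is [P] times the derivative of [Q / P] along [z], and the second witness is [P] times its
   second derivative. Both depend on the component [k] only, so they serve every [j]. *)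
pose beta := DQ u - DP u * Q u / P u.
exists beta, ('D_z DQ u - 'D_z DP u * Q u / P u - 2 * DP u * beta / P u).
move=> j; have E2 : DF z' j u = Q u / P u * DF z j u.
  by apply: (mulfI P0); rewrite [LHS]rank1 // -/(Q u) -/(DF z j u); field.
have E1 : DDF z z' j u = (Q u * DDF z z j u + beta * DF z j u) / P u.
  exact: rank_one_first P0 E2 (G1_0 j u Uu).
split.
- rewrite dir; last exact: smooth_on_differentiable Uu.
  by rewrite rank1 // subrr.
- rewrite dir; last exact: smooth_on_differentiable (sDF z j) Uu.
  rewrite (smooth_on_symmetric z z' oU (sF j) Uu).
  rewrite -[LHS]/(P u * DDF z z' j u - Q u * DDF z z j u) E1 -[in RHS]/(DF z j u).
  by rewrite [P u * _]mulrC divfK // addrC addKr.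
- apply: etrans (dir (DDF z z j) (smooth_on_differentiable (sD z (DF z j) (sDF z j)) Uu)) _.
  have S : 'D_z' (DDF z z j) u = 'D_z (DDF z z' j) u.
    apply: etrans (smooth_on_symmetric z z' oU (sDF z j) Uu) _.
    by apply: (@derive_eq_on _ _ _ U _ _ z u oU Uu) => v Uv; exact: (smooth_on_symmetric z z' oU (sF j) Uv).
  apply: etrans (congr1 (fun t => P u * t - Q u * 'D_z (DDF z z j) u) S) _.
  exact: rank_one_second P0 E2 E1 (G2_0 j).
Qed.
End RankOne.

(** * The focal system in terms of the frame N, T, S *)

Ltac differentiable_polynomial :=
  lazymatch goal with
  | |- differentiable_def (cst _) _ => exact: differentiable_cst
  | |- differentiable_def (_ + _) _ => eapply differentiableD; differentiable_polynomial
  | |- differentiable_def (- _) _ => eapply differentiableN; differentiable_polynomial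
  | |- differentiable_def (_ * _) _ => eapply differentiableM; differentiable_polynomial
  | |- _ => eassumption
  end.

Section FocalFrame.
Variables (R : realType) (V : normedModType R) (U : set V).
Hypothesis oU : open U.
Variables (n0 n1 n2 t0 t1 t2 s0 s1 s2 : V -> R) (v0 v1 v2 b c : R).
Hypothesis c_neq0 : c != 0.
Hypothesis dn : forall u, U u ->
  [/\ differentiable n0 u, differentiable n1 u & differentiable n2 u].
Hypothesis dt : forall u, U u ->
  [/\ differentiable t0 u, differentiable t1 u & differentiable t2 u].
Hypothesis ds : forall u, U u ->
  [/\ differentiable s0 u, differentiable s1 u & differentiable s2 u].
Hypothesis nt0 : forall u, U u -> n0 u * t0 u + n1 u * t1 u + n2 u * t2 u = 0.
Hypothesis t_neq0 : forall u, U u -> 0 < t0 u * t0 u + t1 u * t1 u + t2 u * t2 u.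
Hypothesis frame : forall u, U u -> exists w (al be ga : R), al != 0 /\
  [/\ [/\ 'D_w n0 u = al * (n1 u * t2 u - n2 u * t1 u),
          'D_w n1 u = al * (n2 u * t0 u - n0 u * t2 u) &
          'D_w n2 u = al * (n0 u * t1 u - n1 u * t0 u)],
      [/\ 'D_w t0 u = be * t0 u, 'D_w t1 u = be * t1 u & 'D_w t2 u = be * t2 u] &
      [/\ 'D_w s0 u = ga * t0 u + 2 * be * s0 u,
          'D_w s1 u = ga * t1 u + 2 * be * s1 u &
          'D_w s2 u = ga * t2 u + 2 * be * s2 u]].
Hypothesis rel : forall u, U u ->
  (n0 u * s0 u + n1 u * s1 u + n2 u * s2 u
     + c * (t0 u * t0 u + t1 u * t1 u + t2 u * t2 u))
  * (n0 u * v0 + n1 u * v1 + n2 u * v2 - b)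
  + c ^+ 3 * (t0 u * t0 u + t1 u * t1 u + t2 u * t2 u) = 0.

(** Along [w], N turns by [al] times N x T, T is scaled by [be], and S changes by [ga] T + 2 [be] S.
    Vector identities then give the linear system of [focal_system], up to multiples of <N, T>: the
    factors are [al] <T, v> for [m], [ga] for [p] and [- al] <T, S> for [e]. *)
Lemma focal_frame : forall u, U u ->
  n0 u * v0 + n1 u * v1 + n2 u * v2 = 0 /\ b = c ^+ 2.
Proof.
pose h : V -> R := n0 * cst v0 + n1 * cst v1 + n2 * cst v2.
pose m : V -> R := (n1 * t2 - n2 * t1) * cst v0 + (n2 * t0 - n0 * t2) * cst v1
  + (n0 * t1 - n1 * t0) * cst v2.
pose p : V -> R := n0 * s0 + n1 * s1 + n2 * s2.
pose e : V -> R := (n1 * s2 - n2 * s1) * t0 + (n2 * s0 - n0 * s2) * t1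
  + (n0 * s1 - n1 * s0) * t2.
pose Q : V -> R := t0 * t0 + t1 * t1 + t2 * t2.
have dpoly : forall u, U u -> [/\ differentiable h u, differentiable m u, differentiable p u,
    differentiable e u & differentiable Q u].
  move=> u Uu; have [dn0 dn1 dn2] := dn Uu; have [dt0 dt1 dt2] := dt Uu.
  have [ds0 ds1 ds2] := ds Uu.
  by split; [rewrite /h|rewrite /m|rewrite /p|rewrite /e|rewrite /Q]; differentiable_polynomial.
suff along : forall u, U u -> exists w (al be : R), al != 0 /\
    [/\ 'D_w h u = al * m u, 'D_w m u = be * m u - al * Q u * h u,
        'D_w p u = 2 * be * p u - al * e u,
        'D_w e u = al * Q u * p u + 3 * be * e u & 'D_w Q u = 2 * be * Q u].
  exact: (focal_system oU c_neq0 t_neq0 dpoly along rel).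
move=> u Uu; have [w [al [be [ga [al0 [[E0 E1 E2] [F0 F1 F2] [G0 G1 G2]]]]]]] := frame Uu.
exists w, al, be; split=> //.
have nt := nt0 Uu.
have [dn0 dn1 dn2] := dn Uu; have [dt0 dt1 dt2] := dt Uu; have [ds0 ds1 ds2] := ds Uu.
have di (f : V -> R) (x : R) : differentiable f u -> 'D_w f u = x -> is_derive u w f x.
  by move=> df <-; split=> //; exact: diff_derivable.
have {dn0}E0 := di _ _ dn0 E0; have {dn1}E1 := di _ _ dn1 E1; have {dn2}E2 := di _ _ dn2 E2.
have {dt0}F0 := di _ _ dt0 F0; have {dt1}F1 := di _ _ dt1 F1; have {dt2}F2 := di _ _ dt2 F2.
have {ds0}G0 := di _ _ ds0 G0; have {ds1}G1 := di _ _ ds1 G1; have {ds2}G2 := di _ _ ds2 G2.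
have val (f : V -> R) (x y : R) : is_derive u w f x -> x = y -> 'D_w f u = y.
  by move=> [_ ->].
have mE : m u = (n1 u * t2 u - n2 u * t1 u) * v0 + (n2 u * t0 u - n0 u * t2 u) * v1
  + (n0 u * t1 u - n1 u * t0 u) * v2 by [].
have hE : h u = n0 u * v0 + n1 u * v1 + n2 u * v2 by [].
have pE : p u = n0 u * s0 u + n1 u * s1 u + n2 u * s2 u by [].
have QE : Q u = t0 u * t0 u + t1 u * t1 u + t2 u * t2 u by [].
have eE : e u = (n1 u * s2 u - n2 u * s1 u) * t0 u + (n2 u * s0 u - n0 u * s2 u) * t1 u
  + (n0 u * s1 u - n1 u * s0 u) * t2 u by [].
rewrite mE hE pE QE eE; split.
- eapply val; first (rewrite /h; derive_polynomial).
  by rewrite !fctE /=; ring.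
- eapply val; first (rewrite /m; derive_polynomial).
  have := congr1 ( *%R (al * (t0 u * v0 + t1 u * v1 + t2 u * v2))) nt.
  by rewrite !fctE /= mulr0 => N; apply/eqP; rewrite -subr_eq0 -[X in _ == X]N; apply/eqP; ring.
- eapply val; first (rewrite /p; derive_polynomial).
  have := congr1 ( *%R ga) nt.
  by rewrite mulr0 => N; apply/eqP; rewrite -subr_eq0 -[X in _ == X]N; apply/eqP; ring.
- eapply val; first (rewrite /e; derive_polynomial).
  have := congr1 ( *%R (- al * (t0 u * s0 u + t1 u * s1 u + t2 u * s2 u))) nt.
  by rewrite !fctE /= mulr0 => N; apply/eqP; rewrite -subr_eq0 -[X in _ == X]N; apply/eqP; ring.
- eapply val; first (rewrite /Q; derive_polynomial).
  by ring.
Qed.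
End FocalFrame.

(** * The focal map in a chart *)

Local Notation o0 := (@Ordinal 3 0 isT).
Local Notation o1 := (@Ordinal 3 1 isT).
Local Notation o2 := (@Ordinal 3 2 isT).

Lemma ord3P (i : 'I_3) : [\/ i = o0, i = o1 | i = o2].
Proof.
case: i => [[|[|[|//]]] lt_i].
- by apply: Or31; apply: val_inj.
- by apply: Or32; apply: val_inj.
- by apply: Or33; apply: val_inj.
Qed.

Lemma dotv3E (R : realType) (x y : 'rV[R]_3) :
  dotv x y = x 0 o0 * y 0 o0 + x 0 o1 * y 0 o1 + x 0 o2 * y 0 o2.
Proof.
rewrite /dotv !big_ord_recl big_ord0 addr0 addrA.
by do 2?[congr (_ + _)]; congr (x 0 _ * y 0 _); apply: val_inj.
Qed.

(** On two indices [rev_ord] exchanges them, so [rev_ord i] names the other coordinate direction. *)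
Lemma rev_ord2_neq (i : 'I_2) : rev_ord i != i.
Proof. by case: i => [[|[|//]] ?]. Qed.

Lemma basis2E (R : realType) (i : 'I_2) (w : 'rV[R]_2) :
  w = w 0 i *: 'e_i + w 0 (rev_ord i) *: 'e_(rev_ord i).
Proof.
rewrite {1}[w]row_sum_delta (bigD1 i) //= (bigD1 (rev_ord i))  ?rev_ord2_neq //=.
rewrite big_pred0 ?addr0 // => j; case: i j => [[|[|//]] ?] [[|[|//]] ?] //=.
Qed.

(** Cayley-Hamilton. For row vectors it says that every combination of rows of [A - a%:M] is zero or
    an eigenvector of [A] for [b]. *)
Lemma char_poly2_roots (R : realType) (A : 'M[R]_2) (a b : R) :
  char_poly A = ('X - a%:P) * ('X - b%:P) -> (A - a%:M) *m (A - b%:M) = 0.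
Proof.
move=> E; have := Cayley_Hamilton A; rewrite E rmorphM /= !rmorphB /=.
by rewrite horner_mx_X !horner_mx_C.
Qed.

Lemma proportional (R : comPzRingType) (a b p q r s : R) : GRing.lreg b ->
  a * p + b * s = 0 -> a * q + b * r = 0 -> p * r = s * q.
Proof.
move=> breg E1 E2; apply: breg; apply/eqP; rewrite -subr_eq0; apply/eqP.
transitivity (p * (a * q + b * r) - q * (a * p + b * s)); first by ring.
by rewrite E1 E2 !mulr0 subr0.
Qed.

Lemma sum_sqr3_gt0 (R : realDomainType) (t : 'I_3 -> R) j :
  t j != 0 -> 0 < t o0 * t o0 + t o1 * t o1 + t o2 * t o2.
Proof.
move=> tj; have sq (a : R) : 0 <= a * a by rewrite -expr2 sqr_ge0.
have sp : 0 < t j * t j by rewrite -expr2 exprn_even_gt0.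
have := (sq (t o0), sq (t o1), sq (t o2)) => -[[q0 q1] q2].
by have [E|E|E] := ord3P j; rewrite E in sp; lra.
Qed.

(** A vector orthogonal to both n and t is a multiple of n x t, with factor <a, n x t> / <t, t>.
    [key] is one component of the expansion of a along n, t and n x t, multiplied by the Gram
    determinant of n and t. *)
Lemma cross_collinear (F : fieldType) (a0 a1 a2 n0 n1 n2 t0 t1 t2 : F) :
  n0 * n0 + n1 * n1 + n2 * n2 = 1 -> n0 * t0 + n1 * t1 + n2 * t2 = 0 ->
  t0 * t0 + t1 * t1 + t2 * t2 != 0 ->
  n0 * a0 + n1 * a1 + n2 * a2 = 0 -> t0 * a0 + t1 * a1 + t2 * a2 = 0 ->
  exists al, [/\ a0 = al * (n1 * t2 - n2 * t1), a1 = al * (n2 * t0 - n0 * t2) &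
    a2 = al * (n0 * t1 - n1 * t0)].
Proof.
move=> nn nt; set Q := (X in X != 0) => Q0 na ta.
pose m0 := n1 * t2 - n2 * t1; pose m1 := n2 * t0 - n0 * t2; pose m2 := n0 * t1 - n1 * t0.
exists ((a0 * m0 + a1 * m1 + a2 * m2) / Q).
have key (a m n t : F) : a * ((n0 * n0 + n1 * n1 + n2 * n2) * Q
      - (n0 * t0 + n1 * t1 + n2 * t2) ^+ 2)
    = (a0 * m0 + a1 * m1 + a2 * m2) * m
      + (n0 * a0 + n1 * a1 + n2 * a2) * (Q * n - (n0 * t0 + n1 * t1 + n2 * t2) * t)
      + (t0 * a0 + t1 * a1 + t2 * a2) * (t * (n0 * n0 + n1 * n1 + n2 * n2)
        - n * (n0 * t0 + n1 * t1 + n2 * t2)) ->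
    a = (a0 * m0 + a1 * m1 + a2 * m2) / Q * m.
  rewrite nn nt na ta expr0n subr0 mul1r !mul0r !addr0 => E.
  by apply: (mulIf Q0); rewrite E mulrAC divfK.
by split; [apply: (key a0 m0 n0 t0)|apply: (key a1 m1 n1 t1)|apply: (key a2 m2 n2 t2)];
  rewrite /m0 /m1 /m2 /Q; ring.
Qed.

(** If ([a], [b]) and ([- q], [p]) both lie in the kernel line of ([p], [q]), they are parallel;
    hence derivatives along them are proportional, with the factor stated. *)
Lemma transport_along (R : comPzRingType) (a b p q r s : R) :
  a * p + b * q = 0 -> p * (a * r + b * s) = b * (p * s + - q * r).
Proof.
move=> E; apply/eqP; rewrite -subr_eq0; apply/eqP.
by rewrite -[RHS](mulr0 r) -E; ring.
Qed.

Lemma proportional_combination (F : fieldType) (p b t0 t1 t2 d0 d1 d2 e0 e1 e2 : F) :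
  p != 0 -> p * d0 = b * e0 -> p * d1 = b * e1 -> p * d2 = b * e2 ->
  t0 * e0 + t1 * e1 + t2 * e2 = 0 -> t0 * d0 + t1 * d1 + t2 * d2 = 0.
Proof.
move=> p0 E0 E1 E2 E; apply: (mulfI p0).
rewrite !mulrDr ![p * (_ * _)]mulrCA E0 E1 E2 mulr0 -[RHS](mulr0 b) -E; ring.
Qed.

(** Here d is the derivative of N along z and e its derivative along a kernel vector of the focal
    differential. The conclusion is [c] times <T, e> = 0, after <T, d> is replaced by - <N, S> and
    [c * k] by [h + l]. *)
Lemma focal_relation (F : fieldType) (c k l h n0 n1 n2 t0 t1 t2 s0 s1 s2 d0 d1 d2 e0 e1 e2 : F) :
  c != 0 -> c * k = h + l ->
  n0 * s0 + t0 * d0 + (n1 * s1 + t1 * d1) + (n2 * s2 + t2 * d2) = 0 ->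
  e0 = c * (d0 + k * (t0 - c^-1 * d0)) -> e1 = c * (d1 + k * (t1 - c^-1 * d1)) ->
  e2 = c * (d2 + k * (t2 - c^-1 * d2)) -> t0 * e0 + t1 * e1 + t2 * e2 = 0 ->
  (n0 * s0 + n1 * s1 + n2 * s2 + c * (t0 * t0 + t1 * t1 + t2 * t2)) * (h - (c ^+ 2 - l))
    + c ^+ 3 * (t0 * t0 + t1 * t1 + t2 * t2) = 0.
Proof.
move=> c0 ck E1 -> -> -> E2; have -> : h = c * k - l by rewrite ck addrK.
set X := n0 * s0 + _ + _ in E1 *; set Y := t0 * (c * _) + _ + _ in E2.
rewrite -[RHS](mulr0 c) -[in RHS]E2 -[LHS]subr0 -[X in _ - X = _](mulr0 (c * k - c ^+ 2)) -[in LHS]E1.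
by rewrite /X /Y; field.
Qed.

Section FocalChart.
Variables (R : realType) (U : set 'rV[R]_2) (x n : 'I_3 -> 'rV[R]_2 -> R).
Variables (v : 'rV[R]_3) (k : 'rV[R]_2 -> R) (c lambda : R).
Local Notation V := 'rV[R]_2.
Hypothesis oU : open U.
Hypothesis sx : forall j, smooth_on U (x j).
Hypothesis sn : forall j, smooth_on U (n j).
Hypothesis nn1 : forall u, U u ->
  n o0 u * n o0 u + n o1 u * n o1 u + n o2 u * n o2 u = 1.
Hypothesis nx0 : forall u w, U u ->
  n o0 u * 'D_w (x o0) u + n o1 u * 'D_w (x o1) u + n o2 u * 'D_w (x o2) u = 0.
Hypothesis dx_inj : forall u w, U u -> (forall j, 'D_w (x j) u = 0) -> w = 0.
Hypothesis shape : forall u, U u -> exists2 A : 'M[R]_2,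
  (forall w j, 'D_(w *m A) (x j) u = - 'D_w (n j) u) &
  char_poly A = ('X - c%:P) * ('X - (k u)%:P).
Hypothesis c_neq0 : c != 0.
Hypothesis soliton : forall u, U u ->
  c * k u = n o0 u * v 0 o0 + n o1 u * v 0 o1 + n o2 u * v 0 o2 + lambda.

Let y j : V -> R := x j + c^-1 *: n j.

Let sy j : smooth_on U (y j). Proof. exact: smooth_onDZ. Qed.

Let der (G : V -> R) u w : smooth_on U G -> U u -> is_derive u w G ('D_w G u).
Proof. by move=> sG Uu; split=> //; apply/diff_derivable/(smooth_on_differentiable sG). Qed.

Let dyE u w j : U u -> 'D_w (y j) u = 'D_w (x j) u + c^-1 * 'D_w (n j) u.
Proof.
move=> Uu; have [d1 _] := der w (sx j) Uu; have [d2 _] := der w (sn j) Uu.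
by rewrite /y deriveD ?deriveZ //; exact: derivableZ.
Qed.

Let dir (G : V -> R) u (a b : R) z z' : smooth_on U G -> U u ->
  'D_(a *: z + b *: z') G u = a * 'D_z G u + b * 'D_z' G u.
Proof.
move=> sG Uu; have dG := smooth_on_differentiable sG Uu.
by rewrite derive_dirD // !derive_dirZ.
Qed.

Let ndn0 u w : U u ->
  n o0 u * 'D_w (n o0) u + n o1 u * 'D_w (n o1) u + n o2 u * 'D_w (n o2) u = 0.
Proof.
move=> Uu; pose g : V -> R := n o0 * n o0 + n o1 * n o1 + n o2 * n o2 + - cst 1.
have g0 u' : U u' -> g u' = 0.
  by move=> Uu'; apply/eqP; rewrite [_ == _]subr_eq0; apply/eqP; exact: nn1.
have d j := der w (sn j) Uu.
have E := is_derive_eq0 oU g0 Uu (is_derive_add (is_derive_add (is_derive_add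
  (is_derive_mul (d o0) (d o0)) (is_derive_mul (d o1) (d o1)))
  (is_derive_mul (d o2) (d o2))) (is_derive_opp (is_derive_cst (1 : R) u w))).
lra.
Qed.

Let ndy0 u w : U u ->
  n o0 u * 'D_w (y o0) u + n o1 u * 'D_w (y o1) u + n o2 u * 'D_w (y o2) u = 0.
Proof.
move=> Uu; rewrite !dyE //.
have := nx0 w Uu; have := congr1 ( *%R c^-1) (ndn0 w Uu); lra.
Qed.

(** In a principal direction for [c] the normal satisfies dN = - c dx, which is exactly the
    vanishing of the focal differential. *)
Let eigen_dy0 u (A : 'M[R]_2) w : U u -> w *m A = c *: w ->
  (forall w j, 'D_(w *m A) (x j) u = - 'D_w (n j) u) -> forall j, 'D_w (y j) u = 0.
Proof.
move=> Uu wA hA j; rewrite dyE // -[X in _ * X]opprK -hA wA.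
by rewrite derive_dirZ ?mulrN ?mulKf ?subrr //; exact: smooth_on_differentiable (sx j) Uu.
Qed.

(** On the open set where a fixed coordinate derivative of the component [y j0] does not vanish, T =
    ['D_z y] and S = ['D_z T] satisfy the hypotheses of [focal_frame]. *)
Lemma focal_chart u0 w0 j0 : U u0 -> 'D_w0 (y j0) u0 != 0 ->
  n o0 u0 * v 0 o0 + n o1 u0 * v 0 o1 + n o2 u0 * v 0 o2 = 0 /\ lambda = 0.
Proof.
move=> Uu0 dy_neq0.
have [i dyi] : exists i, 'D_('e_i) (y j0) u0 != 0.
  apply/existsP; apply: contraNT dy_neq0; rewrite negb_exists => /forallP d0.
  rewrite derive_rowE; last exact: smooth_on_differentiable (sy j0) Uu0.
  by rewrite big1 // => i _; have := d0 i; rewrite negbK => /eqP->; rewrite scaler0.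
pose z : V := 'e_i; pose z' : V := 'e_(rev_ord i).
pose U' : set V := [set u | U u /\ 'D_z (y j0) u != 0].
have oU' : open U'.
  rewrite openE => u [Uu du]; apply: filterI; first by apply: open_nbhs_nbhs.
  have cd : {for u, continuous ('D_z (y j0))} by exact: smooth_on_derive_continuous (sy j0) Uu.
  exact: (cvgr_neq0 _ cd du).
have sub u : U' u -> U u by case.
have sU' (G : V -> R) : smooth_on U G -> smooth_on U' G by move=> sG s u /sub; exact: sG.
have kernel u w : U' u -> (forall j, 'D_w (y j) u = 0) ->
    w 0 i * 'D_z (y j0) u + w 0 (rev_ord i) * 'D_z' (y j0) u = 0.
  by move=> [Uu _] /(_ j0); rewrite {1}[w](basis2E i) (dir _ _ _ _ (sy j0) Uu).
have rank1 j u : U' u ->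
    'D_z (y j0) u * 'D_z' (y j) u = 'D_z' (y j0) u * 'D_z (y j) u.
  move=> U'u; have [Uu du] := U'u; have [A hA cA] := shape Uu.
  have /eigenvalueP[w wA w0'] : eigenvalue A c.
    by rewrite eigenvalue_root_char cA rootM !root_XsubC eqxx.
  have dw := eigen_dy0 Uu wA hA; have K := kernel u w U'u dw.
  have := dw j; rewrite {1}[w](basis2E i) (dir _ _ _ _ (sy j) Uu) -/z -/z' => Kj.
  (* If the eigenvector had no component along z', the kernel relation would kill its component
     along z as well. *)
  have b0 : w 0 (rev_ord i) != 0.
    apply: contraNneq w0' => b0; move: K; rewrite b0 mul0r addr0 => /eqP.
    rewrite mulf_eq0 (negPf du) orbF => /eqP a0.
    by rewrite [w](basis2E i) a0 b0 !scale0r addr0.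
  exact: proportional (mulfI b0) K Kj.
have frame0 u (U'u : U' u) := rank_one_along oU' (fun j => sU' _ (sy j))
  (fun u (U'u : U' u) => U'u.2) rank1 U'u.
pose t j : V -> R := 'D_z (y j); pose s j : V -> R := 'D_z (t j).
have st j : smooth_on U (t j) by exact: smooth_on_derive.
have ss j : smooth_on U (s j) by exact: smooth_on_derive.
have nt0 u : U' u -> n o0 u * t o0 u + n o1 u * t o1 u + n o2 u * t o2 u = 0.
  by move=> [Uu _]; exact: ndy0.
have t_gt0 u : U' u -> 0 < t o0 u * t o0 u + t o1 u * t o1 u + t o2 u * t o2 u.
  by move=> [_ tj]; apply: (@sum_sqr3_gt0 _ (t ^~ u) j0).
have dnt0 u w : U' u ->
    n o0 u * 'D_w (t o0) u + t o0 u * 'D_w (n o0) u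
    + (n o1 u * 'D_w (t o1) u + t o1 u * 'D_w (n o1) u)
    + (n o2 u * 'D_w (t o2) u + t o2 u * 'D_w (n o2) u) = 0.
  move=> U'u; have Uu := sub u U'u.
  have d j := der w (sn j) Uu; have d' j := der w (st j) Uu.
  exact: (is_derive_eq0 oU' nt0 U'u (is_derive_add (is_derive_add
    (is_derive_mul (d o0) (d' o0)) (is_derive_mul (d o1) (d' o1)))
    (is_derive_mul (d o2) (d' o2)))).
pose om u := 'D_z (y j0) u *: z' - 'D_z' (y j0) u *: z.
(* Differentiate <N, T> = 0 along the kernel direction [om]: as T only gets scaled there, <N, dT>
   vanishes, and so does <T, dN>. *)
have tdn0 u : U' u -> t o0 u * 'D_(om u) (n o0) u + t o1 u * 'D_(om u) (n o1) u
    + t o2 u * 'D_(om u) (n o2) u = 0.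
  move=> U'u; have [be [ga fr]] := frame0 u U'u.
  have N := dnt0 u (om u) U'u.
  have E j : 'D_(om u) (t j) u = be * t j u by have [_ -> _] := fr j.
  rewrite !E in N; apply: (@eq_trans _ _ (_ - be * 0)); last by rewrite mulr0 subr0; exact: N.
  by rewrite -(nt0 u U'u); ring.
have fdif (G : 'I_3 -> V -> R) : (forall j, smooth_on U (G j)) -> forall u, U' u ->
    [/\ differentiable (G o0) u, differentiable (G o1) u & differentiable (G o2) u].
  by move=> sG u [Uu _]; split; apply: smooth_on_differentiable (sG _) Uu.
have frame u : U' u -> exists w (al be ga : R), al != 0 /\
  [/\ [/\ 'D_w (n o0) u = al * (n o1 u * t o2 u - n o2 u * t o1 u),
          'D_w (n o1) u = al * (n o2 u * t o0 u - n o0 u * t o2 u) &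
          'D_w (n o2) u = al * (n o0 u * t o1 u - n o1 u * t o0 u)],
      [/\ 'D_w (t o0) u = be * t o0 u, 'D_w (t o1) u = be * t o1 u
        & 'D_w (t o2) u = be * t o2 u] &
      [/\ 'D_w (s o0) u = ga * t o0 u + 2 * be * s o0 u,
          'D_w (s o1) u = ga * t o1 u + 2 * be * s o1 u &
          'D_w (s o2) u = ga * t o2 u + 2 * be * s o2 u]].
  move=> U'u; have [Uu du] := U'u; have [be [ga fr]] := frame0 u U'u.
  have [al [a0 a1 a2]] := cross_collinear (nn1 Uu) (nt0 u U'u)
    (lt0r_neq0 (t_gt0 u U'u)) (ndn0 (om u) Uu) (tdn0 u U'u).
  exists (om u), al, be, ga; split; last first.
    have [_ b0 c0] := fr o0; have [_ b1 c1] := fr o1; have [_ b2 c2] := fr o2.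
    exact: (And3 (And3 a0 a1 a2) (And3 b0 b1 b2) (And3 c0 c1 c2)).
  (* If [al] were zero, dN and dy would both vanish along [om], hence dx too; by injectivity [om] is
     zero, although its z' component is the nonzero ['D_z (y j0) u]. *)
  apply/eqP => al0; move/eqP: du; apply.
  have dn0 j : 'D_(om u) (n j) u = 0.
    by have [->|->|->] := ord3P j; rewrite ?a0 ?a1 ?a2 al0 mul0r.
  have om0 : om u = 0.
    apply: (dx_inj Uu) => j; have [Y _ _] := fr j.
    by rewrite -[RHS]Y -/(om u) dyE // dn0 mulr0 addr0.
  have := congr1 (fun w : V => w 0 (rev_ord i)) om0.
  rewrite /om !mxE !eqxx (negPf (rev_ord2_neq i)) /= mulr1 mulr0 subr0; exact.
have rel u : U' u ->
  (n o0 u * s o0 u + n o1 u * s o1 u + n o2 u * s o2 u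
     + c * (t o0 u * t o0 u + t o1 u * t o1 u + t o2 u * t o2 u))
  * (n o0 u * v 0 o0 + n o1 u * v 0 o1 + n o2 u * v 0 o2 - (c ^+ 2 - lambda))
  + c ^+ 3 * (t o0 u * t o0 u + t o1 u * t o1 u + t o2 u * t o2 u) = 0.
  move=> U'u; have [Uu du] := U'u; have [A hA cA] := shape Uu.
  (* By Cayley-Hamilton this vector satisfies [p *m A = c *: p], so it lies in the kernel of dy, and
     the derivative of N along it is explicit in terms of the derivatives along z. *)
  pose p := z *m (A - (k u)%:M).
  have pA : p *m A = c *: p.
    rewrite mulrC in cA; have := char_poly2_roots cA.
    move=> /(congr1 (mulmx z)); rewrite mulmx0 mulmxA mulmxBr mul_mx_scalar.
    by move/eqP; rewrite subr_eq0 => /eqP.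
  have dp := eigen_dy0 Uu pA hA; have K := kernel u p U'u dp.
  have dpn j : 'D_z (y j0) u * 'D_p (n j) u = p 0 (rev_ord i) * 'D_(om u) (n j) u.
    rewrite {1}[p](basis2E i) (dir _ _ _ _ (sn j) Uu).
    by rewrite /om -scaleNr (dir _ _ _ _ (sn j) Uu); exact: transport_along K.
  have tdp : t o0 u * 'D_p (n o0) u + t o1 u * 'D_p (n o1) u + t o2 u * 'D_p (n o2) u = 0.
    exact: proportional_combination du (dpn o0) (dpn o1) (dpn o2) (tdn0 u U'u).
  have dpx j : 'D_p (n j) u = c * ('D_z (n j) u + k u * (t j u - c^-1 * 'D_z (n j) u)).
    have := dp j; rewrite dyE // /t dyE // addrK => /eqP; rewrite addrC addr_eq0 => /eqP E.
    apply: (mulfI (invr_neq0 c_neq0)); rewrite E mulKf //.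
    rewrite /p mulmxBr mul_mx_scalar -scaleNr.
    have dxu := smooth_on_differentiable (sx j) Uu.
    by rewrite derive_dirD // derive_dirZ // hA opprD opprK scaleNr opprK.
  have nk := soliton Uu; have nts := dnt0 u z U'u.
  exact: focal_relation c_neq0 nk nts (dpx o0) (dpx o1) (dpx o2) tdp.
have dnU u (U'u : U' u) := fdif n sn u U'u.
have [->] := focal_frame oU' c_neq0 dnU (fdif t st) (fdif s ss) nt0 t_gt0 frame rel (conj Uu0 dyi).
(* The parameter [b] is [c ^+ 2 - lambda] here, so [b = c ^+ 2] means [lambda = 0]. *)
by move=> /eqP; rewrite subr_eq addrC -subr_eq subrr eq_sym => /eqP.
Qed.
End FocalChart.

(** * Euclidean linear algebra *)

Section LinearMaps.
Variable R : realType.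

Lemma linear_rV_continuous n (W : normedModType R) (L : {linear 'rV[R]_n -> W}) :
  continuous L.
Proof.
move=> x.
have -> : (L : 'rV[R]_n -> W) = \sum_i (fun w : 'rV[R]_n => w 0 i *: L 'e_i).
  apply/funext => w; rewrite fct_sumE {1}[w]row_sum_delta linear_sum.
  by apply: eq_bigr => i _; rewrite linearZ.
apply: differentiable_continuous; apply: differentiable_sum => i.
apply: (differentiableZl (k := fun w : 'rV[R]_n => w 0 i)).
exact: differentiable_coord.
Qed.

Lemma dotv_is_linear n (a : 'rV[R]_n) : linear (dotv a : 'rV[R]_n -> R).
Proof.
move=> k x y; rewrite /dotv scaler_sumr -big_split /=; apply: eq_bigr => i _.
by rewrite !mxE mulrDr mulrCA.
Qed.
HB.instance Definition _ n (a : 'rV[R]_n) :=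
  GRing.isLinear.Build R 'rV[R]_n R _ (dotv a) (dotv_is_linear a).

Lemma dotvC n (x y : 'rV[R]_n) : dotv x y = dotv y x.
Proof. by apply: eq_bigr => i _; rewrite mulrC. Qed.

Lemma dotvDr n (x y z : 'rV[R]_n) : dotv z (x + y) = dotv z x + dotv z y.
Proof. exact: linearD. Qed.

Lemma dotvBr n (x y z : 'rV[R]_n) : dotv z (x - y) = dotv z x - dotv z y.
Proof. exact: linearB. Qed.

Lemma dotvZr n k (x z : 'rV[R]_n) : dotv z (k *: x) = k * dotv z x.
Proof. exact: linearZ. Qed.

Lemma dotvDl n (x y z : 'rV[R]_n) : dotv (x + y) z = dotv x z + dotv y z.
Proof. by rewrite ![dotv _ z]dotvC dotvDr. Qed.

Lemma dotvZl n k (x z : 'rV[R]_n) : dotv (k *: x) z = k * dotv x z.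
Proof. by rewrite ![dotv _ z]dotvC dotvZr. Qed.

Lemma dotv_ge0 n (x : 'rV[R]_n) : 0 <= dotv x x.
Proof. by apply: sumr_ge0 => i _; rewrite -expr2 sqr_ge0. Qed.

Lemma dotv_eq0 n (x : 'rV[R]_n) : (dotv x x == 0) = (x == 0).
Proof.
rewrite psumr_eq0; last by move=> i _; rewrite -expr2 sqr_ge0.
apply/allP/eqP => [x0|-> i _]; last by rewrite /= !mxE mulr0.
apply/rowP => i; have := x0 i (mem_index_enum i).
by rewrite /= -expr2 sqrf_eq0 mxE => /eqP.
Qed.

(** The orthogonal projection to the complement of [v] for unit [v], the case in which it is
    used. *)
Definition orthoproj n (v x : 'rV[R]_n) := x - dotv v x *: v.

Lemma orthoproj_is_linear n (v : 'rV[R]_n) : linear (orthoproj v).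
Proof.
move=> k x y; rewrite /orthoproj.
have -> : dotv v (k *: x + y) = k * dotv v x + dotv v y by exact: dotv_is_linear.
by apply/rowP => i; rewrite !mxE; ring.
Qed.
HB.instance Definition _ n (v : 'rV[R]_n) :=
  GRing.isLinear.Build R 'rV[R]_n 'rV[R]_n _ (orthoproj v) (orthoproj_is_linear v).

Lemma derive_linear (V W W' : normedModType R) (f : V -> W) (L : {linear W -> W'}) x w :
  continuous L -> differentiable f x -> 'D_w (L \o f) x = L ('D_w f x).
Proof.
move=> cL df; have dL : differentiable L (f x) by apply/linear_differentiable/cL.
rewrite deriveE; last exact: differentiable_comp.
by rewrite diff_comp //= diff_lin // deriveE.
Qed.

Definition cross (x y : 'rV[R]_3) : 'rV[R]_3 :=
  \row_i [:: x 0 o1 * y 0 o2 - x 0 o2 * y 0 o1; x 0 o2 * y 0 o0 - x 0 o0 * y 0 o2;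
             x 0 o0 * y 0 o1 - x 0 o1 * y 0 o0]`_i.

(** The remainder of the expansion is orthogonal to [n] and [v], hence a multiple of their cross
    product by [cross_collinear]; it is orthogonal to that as well, so it vanishes. *)
Lemma dotv_cross (n v x : 'rV[R]_3) :
  dotv n n = 1 -> dotv v v = 1 -> dotv n v = 0 ->
  let w := cross n v in
  [/\ dotv w w = 1, dotv w v = 0, dotv w n = 0 &
      x = dotv w x *: w + dotv v x *: v + dotv n x *: n].
Proof.
move=> nn vv nv w.
have ww : dotv w w = 1.
  have -> : dotv w w = dotv n n * dotv v v - dotv n v ^+ 2.
    by rewrite !dotv3E !mxE /=; ring.
  by rewrite nn vv nv expr0n mulr1 subr0.
have wv : dotv w v = 0 by rewrite !dotv3E !mxE /=; ring.
have wn : dotv w n = 0 by rewrite !dotv3E !mxE /=; ring.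
split=> //; apply/eqP; rewrite -subr_eq0; set r := _ - _.
have rE a : dotv a r = dotv a x - (dotv w x * dotv a w + dotv v x * dotv a v + dotv n x * dotv a n).
  by rewrite /r dotvBr !dotvDr !dotvZr.
have nr : dotv n r = 0 by rewrite rE nn nv dotvC [dotv n w]dotvC wn; ring.
have vr : dotv v r = 0 by rewrite rE vv [dotv v w]dotvC wv [dotv v n]dotvC nv; ring.
have wr : dotv w r = 0 by rewrite rE ww wv wn; ring.
rewrite dotv3E in nn; rewrite dotv3E in nv; rewrite dotv3E in vv.
rewrite dotv3E in nr; rewrite dotv3E in vr.
have vv0 : v 0 o0 * v 0 o0 + v 0 o1 * v 0 o1 + v 0 o2 * v 0 o2 != 0 by rewrite vv oner_eq0.
have [al [E0 E1 E2]] := cross_collinear nn nv vv0 nr vr.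
have rw : r = al *: w.
  by apply/rowP => i; rewrite [RHS]mxE [w 0 i]mxE; have [->|->|->] := ord3P i.
have al0 : al = 0 by move: wr; rewrite rw dotvZr ww mulr1.
by rewrite rw al0 scale0r.
Qed.

(** Dimension count: the image of [L] is contained in the orthogonal complement of [n], and both
    have rank 2. *)
Lemma tangent_plane (L : {linear 'rV[R]_2 -> 'rV[R]_3}) (n : 'rV[R]_3) :
  n != 0 -> injective L -> (forall w, dotv n (L w) = 0) ->
  forall y, dotv n y = 0 -> exists w, L w = y.
Proof.
move=> n0 injL nL y ny; pose M := lin1_mx L.
have ME w : w *m M = L w by rewrite mul_rV_lin1.
have dotE (x : 'rV[R]_3) : x *m n^T = (dotv n x)%:M.
  apply/matrixP => i j; rewrite !mxE !ord1 eqxx mulr1n.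
  by apply: eq_bigr => k _; rewrite mxE mulrC.
have rM : \rank M = 2.
  apply/eqP; apply: (inj_row_free (A := M)) => w; rewrite ME => Lw.
  by apply: injL; rewrite Lw linear0.
have Mk : (M <= kermx n^T)%MS.
  apply/row_subP => i; apply/sub_kermxP; rewrite dotE rowE ME nL.
  by rewrite raddf0.
have rk : \rank (kermx n^T) = 2.
  rewrite mxrank_ker mxrank_tr; suff -> : \rank n = 1 by [].
  by rewrite rank_rV n0.
have E : (kermx n^T <= M)%MS by have := mxrank_leqif_sup Mk; rewrite rM rk => -[_ <-].
have /submxP[w yw] : (y <= M)%MS.
  by apply: submx_trans E; apply/sub_kermxP; rewrite dotE ny raddf0.
by exists w; rewrite -ME yw.
Qed.

End LinearMaps.

(** * Projection of a surface to its tangent plane *)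

Lemma dotv_delta (R : realType) n (i : 'I_n) (w : 'rV[R]_n) : dotv 'e_i w = w 0 i.
Proof.
rewrite /dotv (bigD1 i) //= big1 ?addr0 => [|j ji]; rewrite !mxE eqxx /=.
  by rewrite eqxx mul1r.
by rewrite (negPf ji) mul0r.
Qed.

Definition plane_coords (R : realType) m n (a : 'I_m -> 'rV[R]_n) (x : 'rV[R]_n) :
  'rV[R]_m := \row_i dotv (a i) x.

Lemma plane_coords_is_linear (R : realType) m n (a : 'I_m -> 'rV[R]_n) :
  linear (plane_coords a).
Proof.
by move=> k x y; apply/rowP => i; rewrite !mxE; exact: dotv_is_linear.
Qed.
HB.instance Definition _ (R : realType) m n (a : 'I_m -> 'rV[R]_n) :=
  GRing.isLinear.Build R 'rV[R]_n 'rV[R]_m _ (plane_coords a) (plane_coords_is_linear a).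

Section LocalProjection.
Variables (R : realType) (F : 'rV[R]_2 -> 'rV[R]_3) (U : set 'rV[R]_2) (u0 : 'rV[R]_2).
Variables (n : 'rV[R]_3) (a : 'I_2 -> 'rV[R]_3).
Hypothesis oU : open U.
Hypothesis sF : smooth_on U F.
Hypothesis Uu0 : U u0.
Hypothesis dF_inj : injective ('d F u0).
Hypothesis n_neq0 : n != 0.
Hypothesis ndF : forall w, dotv n ('d F u0 w) = 0.
Hypothesis na : forall i, dotv n (a i) = 0.
Hypothesis aa : forall i j, dotv (a i) (a j) = (i == j)%:R.

(** The rows of [B] are the preimages under the differential of the orthonormal tangent vectors [a].
    In the new parameter the projection [P] has the identity as differential at 0, so
    [near_identity] applies with constant 1/2 and [near_identity_surj] gives surjectivity. *)
Lemma local_projection : exists2 B : 'M[R]_2, B \in unitmx &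
  let P x := plane_coords a (F (u0 + x *m B)) in
  \forall r \near 0^'+,
    [/\ forall x, `|x| <= r -> U (u0 + x *m B),
        forall x y, `|x| <= r -> `|y| <= r ->
          `|P x - P y - (x - y)| <= 2^-1 * `|x - y| &
        forall z, `|P 0 - z| <= r / 2 -> exists2 x, `|x| <= r & P x = z].
Proof.
have /choice[xi xiE] : forall i, exists w, 'd F u0 w = a i.
  by move=> i; apply: tangent_plane n_neq0 dF_inj ndF _ _.
pose B := \matrix_i xi i.
have dFB w : 'd F u0 (w *m B) = \sum_i w 0 i *: a i.
  rewrite mulmx_sum_row linear_sum; apply: eq_bigr => i _.
  by rewrite rowK linearZ /= xiE.
have aw i w : dotv (a i) (\sum_j w 0 j *: a j) = w 0 i.
  rewrite linear_sum /= (bigD1 i) //= big1 ?addr0 => [|j ji]; rewrite dotvZr aa.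
    by rewrite eqxx mulr1.
  by rewrite eq_sym (negPf ji) mulr0.
have uB : B \in unitmx.
  rewrite -row_free_unit; apply: inj_row_free => w wB.
  by apply/rowP => i; rewrite -aw -dFB wB linear0 linear0 mxE.
exists B => //= ; pose L := mulmxr B : {linear 'rV[R]_2 -> 'rV[R]_2}.
have cL : continuous L by exact: linear_rV_continuous.
pose U1 : set 'rV[R]_2 := [set x | U (u0 + L x)].
pose G x := F (u0 + L x).
have sG : smooth_on U1 G by exact: smooth_on_affine.
have oU1 : open U1.
  have ca : continuous (fun x => u0 + L x).
    by move=> x; have cx := cL x; apply: cvgD cx; exact: cvg_cst.
  by apply: open_comp oU => x _; exact: ca.
have U10 : U1 0 by rewrite /U1 /= /L /= mul0mx addr0.
pose f i : 'rV[R]_2 -> R := dotv (a i) \o G.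
have sf i : smooth_on U1 (f i).
  by apply: smooth_on_linear => //; exact: linear_rV_continuous.
have dG w : 'D_w G 0 = 'd F u0 (w *m B).
  have Eu : u0 + L 0 = u0 by rewrite linear0 addr0.
  have dF0 : differentiable F (u0 + L 0) by rewrite Eu; exact: smooth_on_differentiable Uu0.
  apply: etrans (derive_affine w cL dF0) _; rewrite Eu; apply: deriveE.
  exact: smooth_on_differentiable sF Uu0.
have Df i w : 'D_w (f i) 0 = dotv 'e_i w.
  rewrite /f derive_linear; [|exact: linear_rV_continuous|exact: smooth_on_differentiable sG U10].
  by rewrite -[LHS]/(dotv (a i) ('D_w G 0)) dG dFB aw dotv_delta.
have cD (i : 'I_2) : continuous (dotv ('e_i : 'rV[R]_2)) by exact: linear_rV_continuous.
have N := near_identity oU1 U10 (fun i u Uu => smooth_on_differentiable (sf i) Uu)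
  (fun i j => smooth_on_derive_continuous (sf i) U10)
  cD Df.
have r0 : \forall r \near (0 : R)^'+, 0 < r by exact: nbhs_right_gt.
have half0 : (0 : R) < 2^-1 by rewrite invr_gt0.
apply: filterS2 (N _ half0) r0 => r [inU near_id] r_gt0.
have inU' x : `|x| <= r -> U1 x by move=> xr; apply: inU; rewrite sub0r normrN.
have est x y : `|x| <= r -> `|y| <= r ->
    `|plane_coords a (G x) - plane_coords a (G y) - (x - y)| <= 2^-1 * `|x - y|.
  move=> xr yr; apply: rV_norm_le => [|i]; first by rewrite mulr_ge0 // ltW.
  have : `|f i x - f i y - dotv 'e_i (x - y)| <= 2^-1 * `|x - y|.
    by apply: near_id; rewrite sub0r normrN.
  by rewrite dotv_delta !mxE.
split=> // z zr.
have cP x : `|0 - x| <= r -> {for x, continuous (plane_coords a \o G)}.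
  rewrite sub0r normrN => /inU' U1x.
  have cG : {for x, continuous G}.
    exact/differentiable_continuous/(smooth_on_differentiable sG U1x).
  have cp : continuous (plane_coords a) by exact: linear_rV_continuous.
  by apply: continuous_comp cG _; exact: cp.
have estP x y : `|0 - x| <= r -> `|0 - y| <= r ->
    `|(plane_coords a \o G) x - (plane_coords a \o G) y - (x - y)| <= 2^-1 * `|x - y|.
  by rewrite !sub0r !normrN; exact: est.
have [x xr E] := near_identity_surj r_gt0 cP estP zr.
by exists x; [move: xr; rewrite sub0r normrN|exact: E].
Qed.
End LocalProjection.

(** * Charts *)

Section Charts.
Variables (R : realType) (Sigma : smooth_surface R).
Implicit Types (f N : Sigma -> 'rV[R]_3) (i : chart Sigma).

(** Parametrizations are open maps: their images are open and the inverse [coord i] is continuous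
    there. *)
Lemma nbhs_param i u (O : set 'rV[R]_2) : pdom i u -> nbhs u O ->
  nbhs (param i u) (param i @` (pdom i `&` O)).
Proof.
move=> iu uO.
have cO : nbhs (param i u) (Defs.coord i @^-1` O).
  by apply: (Defs.coord_continuous iu); rewrite paramK.
have iO : nbhs (param i u) (param i @` pdom i).
  by apply: open_nbhs_nbhs; split; [exact: image_open|exists u].
apply: filterS2 cO iO => q /= Oq [u' iu' uq]; exists u' => //; split=> //.
by move: Oq; rewrite -uq paramK.
Qed.

Lemma open_param i (O : set 'rV[R]_2) : open O -> O `<=` pdom i -> open (param i @` O).
Proof.
move=> oO Oi; rewrite openE => _ [u Ou <-].
have uO : nbhs u O by apply: open_nbhs_nbhs.
apply: filterS (nbhs_param (Oi _ Ou) uO) => q [u' [_ Ou'] <-].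
by exists u'.
Qed.

Lemma surface_connected (P : Sigma -> Prop) :
  (forall p, P p -> \forall q \near p, P q) ->
  (forall p, ~ P p -> \forall q \near p, ~ P q) ->
  forall p q, P p -> P q.
Proof.
move=> oP cP p q Pp.
have oA : open [set p | P p] by rewrite openE => x Px; exact: oP.
have oB : open (~` [set p | P p]) by rewrite openE => x Px; exact: cP.
have -> : P q = [set p | P p] q by [].
rewrite (surf_connected (B := [set p | P p])) //.
- by exists p.
- by exists [set p | P p] => //; rewrite setTI.
- by exists [set p | P p]; [rewrite -openC|rewrite setTI].
Qed.

(** The mean value theorem on a ball of a chart makes [g] locally constant; connectedness does the
    rest. *)
Lemma chart_constant (g : Sigma -> R) :
  (forall i u, pdom i u -> differentiable (g \o param i) u) ->
  (forall i u w, pdom i u -> 'D_w (g \o param i) u = 0) ->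
  forall p q, g p = g q.
Proof.
move=> dg Dg.
have loc p : \forall q \near p, g q = g p.
  have [i [u iu <-]] := chart_cover p.
  have /nbhs_ballP[r /= r0 Br] : nbhs u (pdom i).
    by apply: open_nbhs_nbhs; split; [exact: pdom_open|].
  apply: filterS (nbhs_param iu (nbhsx_ballx u r r0)) => _ [u' [_ ur] <-].
  have inB (t : R) : 0 <= t <= 1 -> pdom i (u + t *: (u' - u)).
    move=> /andP[t0 t1]; apply: Br; move: ur; rewrite -!ball_normE /= => ur.
    rewrite opprD addNKr normrN normrZ (ger0_norm t0) distrC.
    by apply: le_lt_trans ur; rewrite ler_piMl.
  have [t /andP[t0 t1]] := mvt_line (fun t t01 => dg i _ (inB t t01)).
  rewrite Dg; last by apply: inB; rewrite !ltW.
  by rewrite subrKC => /eqP; rewrite subr_eq0 => /eqP.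
move=> p q; apply/esym.
apply: (@surface_connected (fun q => g q = g p) _ _ p) => // x.
  by move=> <-; exact: loc.
by move=> gx; apply: filterS (loc x) => y ->.
Qed.

Lemma smooth_map_continuous f : smooth_map f -> continuous f.
Proof.
move=> sf p; have [i [u iu <-]] := chart_cover p.
have cF : {for u, continuous (f \o param i)}.
  exact/differentiable_continuous/(smooth_on_differentiable (sf i) iu).
move=> A /cF uA; apply: filterS (nbhs_param iu uA) => _ [u' [_ Au'] <-].
exact: Au'.
Qed.

Lemma smooth_map_linear f (L : {linear 'rV[R]_3 -> R}) i :
  smooth_map f -> smooth_on (pdom i) ((L \o f) \o param i).
Proof.
move=> sf; apply: (smooth_on_linear (f := f \o param i)) (sf i).
  exact: linear_rV_continuous.
exact: pdom_open.
Qed.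

Lemma gauss_map_neq0 f N p : gauss_map f N -> N p != 0.
Proof.
move=> [_ N1 _]; rewrite -dotv_eq0 N1; exact: oner_neq0.
Qed.

(** The component of [f] along the constant normal has zero derivative, so the image lies in a
    plane. Local surjectivity of the tangential projection shows that the image is open in that
    plane. *)
Lemma constant_normal_planar f N (p0 : Sigma) : immersion f -> gauss_map f N ->
  (forall p, N p = N p0) -> is_planar f.
Proof.
move=> [sf inj_f] GN Nc; have [sN N1 Nf] := GN.
pose n := N p0; have n0 : n != 0 := gauss_map_neq0 p0 GN.
have dE i u : pdom i u -> differentiable (f \o param i) u.
  by move=> iu; exact: smooth_on_differentiable (sf i) iu.
have fn p : dotv n (f p) = dotv n (f p0).
  apply: (@chart_constant (dotv n \o f)) => i u.
    by move=> iu; exact: smooth_on_differentiable (smooth_map_linear (dotv n) sf) iu.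
  move=> w iu; rewrite (derive_linear (f := f \o param i)); last exact: dE.
    rewrite deriveE; last exact: dE.
    by rewrite /n -(Nc (param i u)); exact: Nf.
  exact: linear_rV_continuous.
pose plane : set 'rV[R]_3 := [set x | dotv (x - f p0) n = 0].
have pE x : plane x <-> dotv n x = dotv n (f p0).
  by rewrite /plane /= dotvC dotvBr; split=> [/eqP|->]; rewrite ?subrr // subr_eq0 => /eqP.
(* The open set is taken as large as possible, so one inclusion is immediate; the other asks that
   all nearby points of the plane are in the image. *)
exists (f p0), n, (interior [set x | plane x -> range f x]); split=> //.
  exact: open_interior.
rewrite eqEsubset; split=> [_ [p _ <-]|x [px /interior_subset]]; last exact.
split; first exact/pE.
have [i [u iu <-]] := chart_cover p.
have nF w : dotv n ('d (f \o param i) u w) = 0.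
  by rewrite /n -(Nc (param i u)); exact: Nf.
have Fe0 : 'd (f \o param i) u 'e_0 != 0.
  apply/eqP => F0; have : 'e_0 = 0 :> 'rV[R]_2.
    by apply: (inj_f _ _ iu); rewrite F0 linear0.
  by move/rowP/(_ 0); rewrite !mxE eqxx /= => /eqP; rewrite oner_eq0.
set e := 'd (f \o param i) u 'e_0 in Fe0.
pose v := (Num.sqrt (dotv e e))^-1 *: e.
have e0 : 0 < dotv e e by rewrite lt_neqAle eq_sym dotv_eq0 Fe0 dotv_ge0.
have nv : dotv n v = 0 by rewrite dotvZr nF mulr0.
have vv : dotv v v = 1.
  rewrite dotvZr dotvZl mulrA -invfM -expr2 sqr_sqrtr; last exact: ltW.
  by rewrite mulVf // gt_eqF.
have nn : dotv n n = 1 by exact: N1.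
have [ww wv wn _] := dotv_cross 0 nn vv nv.
pose a (j : 'I_2) := if j == 0 then cross n v else v.
have na j : dotv n (a j) = 0 by rewrite /a; case: ifP => // _; rewrite dotvC.
have aa j k : dotv (a j) (a k) = (j == k)%:R.
  case: j k => [[|[|//]] ?] [[|[|//]] ?]; rewrite /a /= ?ww ?wv ?vv //.
  by rewrite dotvC wv.
have [B _ locB] := local_projection (@pdom_open _ _ i) (sf i) iu (inj_f _ _ iu) n0 nF na aa.
have r0 : \forall r \near (0 : R)^'+, 0 < r by exact: nbhs_right_gt.
have [r [rpos [inU _ onto]]] := filter_ex (filterI r0 locB).
have cP : continuous (plane_coords a) by exact: linear_rV_continuous.
have /cvgrPdist_lt/(_ (r / 2)) near_u := cP (f (param i u)).
have : \forall x \near f (param i u), `|plane_coords a (f (param i u)) - plane_coords a x| < r / 2.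
  by apply: near_u; rewrite divr_gt0.
apply: filterS => x Px /pE nx.
have [|y yr yE] := onto (plane_coords a x).
  by rewrite mul0mx addr0; exact: ltW.
exists (param i (u + y *m B)) => //.
(* Both points have the same component along [n] and the same tangential coordinates, so their
   expansions in the frame agree. *)
have [_ _ _ ->] := dotv_cross (f (param i (u + y *m B))) nn vv nv.
have [_ _ _ ->] := dotv_cross x nn vv nv.
have E j := congr1 (fun z : 'rV[R]_2 => z 0 j) yE.
have := (E 0, E 1); rewrite !mxE /a /= => -[-> ->].
by rewrite nx fn.
Qed.

End Charts.

(** * Local structure of cylindrical surfaces *)

Lemma zero_derive_littleo (R : realType) (V W : normedModType R) (g : V -> W) a (e : R) :
  differentiable g a -> (forall w, 'D_w g a = 0) -> 0 < e ->
  \forall b \near a, `|g b - g a| <= e * `|b - a|.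
Proof.
move=> dg Dg e0; have /eqaddoP/(_ _ e0) H := diff_locally dg.
have {}H : \forall h \near (0 : V), `|g (h + a) - g a| <= e * `|h|.
  apply: filterS H => h /=.
  rewrite -[X in `|X| <= _ -> _]/(g (h + a) - (g a + 'd g a h)).
  by rewrite -deriveE // Dg addr0.
have cs : (b - a) @[b --> a] --> (0 : V).
  by rewrite -(subrr a); apply: cvgB; [exact: cvg_id|exact: cvg_cst].
have N : \forall b \near a, `|g (b - a + a) - g a| <= e * `|b - a| by exact: (cs _ H).
by apply: filterS N => b; rewrite subrK.
Qed.

(** * Functions constant along the level curves of a coordinate *)

Section LevelCurves.
Variables (R : realType) (P : 'rV[R]_2 -> 'rV[R]_2) (gamma : 'rV[R]_2 -> R) (r : R).
Hypothesis est : forall x y, `|x| <= r -> `|y| <= r ->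
  `|P x - P y - (x - y)| <= 2^-1 * `|x - y|.
Hypothesis onto : forall z, `|P 0 - z| <= r / 2 -> exists2 x, `|x| <= r & P x = z.

Lemma near_identity_inverse_lipschitz x y : `|x| <= r -> `|y| <= r ->
  `|x - y| <= 2 * `|P x - P y|.
Proof.
move=> xr yr; have E := est xr yr.
have : `|x - y| <= `|P x - P y| + `|P x - P y - (x - y)|.
  have {1}-> : x - y = (P x - P y) - (P x - P y - (x - y)) by rewrite opprB addrCA subrr addr0.
  exact: ler_normB.
lra.
Qed.

Hypothesis dP : forall x, `|x| <= r -> differentiable (fun x => P x 0 0) x.
Hypothesis dgamma : forall x, `|x| <= r -> differentiable gamma x.
Hypothesis Dgamma : forall x, `|x| <= r ->
  exists q, forall w, 'D_w gamma x = q * 'D_w (fun x => P x 0 0) x.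

(* Join x to y by the curve psi in the level set of the first coordinate of P;
   gamma has zero derivative along it. *)
Lemma level_curve_constant x y : `|x| <= r -> `|y| <= r ->
  `|P 0 - P x| < r / 2 -> `|P 0 - P y| < r / 2 -> P x 0 0 = P y 0 0 ->
  gamma x = gamma y.
Proof.
move=> xr yr Pxr Pyr Pxy.
(* A right inverse of [P] on the ball where [onto] applies, with default value 0 outside it. *)
have /choice[inv invE] : forall z, exists x, `|P 0 - z| <= r / 2 -> `|x| <= r /\ P x = z.
  move=> z; case: (boolP (`|P 0 - z| <= r / 2)) => [/onto[x' ? ?]|_].
    by exists x'.
  by exists 0.
have invr z : `|P 0 - z| <= r / 2 -> `|inv z| <= r by move=> /invE[].
have Pinv z : `|P 0 - z| <= r / 2 -> P (inv z) = z by move=> /invE[].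
(* The level curve is the image under [inv] of this segment, which stays in the ball and has
   constant first coordinate. *)
pose z (t : R) := P x + t *: (P y - P x).
have zr (t : R) : 0 <= t <= 1 -> `|P 0 - z t| < r / 2.
  move=> t01; apply: (@le_lt_trans _ _ (Num.max `|P 0 - P x| `|P 0 - P y|)).
    by apply: segment_closed_ball => //; rewrite le_max lexx ?orbT.
  by rewrite gt_max Pxr Pyr.
have z00 t : z t 0 0 = P x 0 0 by rewrite !mxE Pxy subrr mulr0 addr0.
have cz : continuous z.
  by move=> t; apply: cvgD; [exact: cvg_cst|exact: scalel_continuous].
pose g t := gamma (inv (z t)).
have dg (t : R) : 0 <= t <= 1 -> is_derive t 1 g 0.
  move=> t01; pose a := inv (z t).
  have ztr : `|P 0 - z t| <= r / 2 := ltW (zr t t01).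
  have ar : `|a| <= r by exact: invr.
  have [q Dq] := Dgamma ar.
  (* [delta] has zero derivative at [a] and the same increments as [gamma] along the level curve. As
     [inv] is Lipschitz, the increments of [g] are little-o, so [inv] need not be differentiated. *)
  pose delta : 'rV[R]_2 -> R := gamma - q *: (fun x => P x 0 0).
  have dqP : differentiable (q *: (fun x => P x 0 0)) a by apply/differentiableZ/dP.
  have ddelta : differentiable delta a by apply: differentiableB => //; exact: dgamma.
  have Ddelta w : 'D_w delta a = 0.
    rewrite /delta deriveB; [|exact/diff_derivable/dgamma|exact: diff_derivable].
    by rewrite deriveZ ?Dq ?subrr //; exact/diff_derivable/dP.
  suff L : (fun h : R => h^-1 *: (g (h *: (1 : R) + t) - g t)) @ 0^' --> (0 : R).
    by split; [apply/cvg_ex; exists 0|exact: (cvg_lim (@Rhausdorff R) L)].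
  pose C := `|P y - P x|.
  apply/cvgrPdist_le => e e0; pose e' := e / (2 * C + 1).
  have C0 : 0 < 2 * C + 1 by apply: ltr_wpDl => //; apply: mulr_ge0 => //; exact: normr_ge0.
  have e'0 : 0 < e' by exact: divr_gt0.
  have /nbhs_normP[eta /= eta0 Heta] := zero_derive_littleo ddelta Ddelta e'0.
  have czt : z (h + t) @[h --> (0 : R)] --> z t.
    rewrite -{2}[t]add0r; apply: (@continuous_comp _ _ _ (fun h : R => h + t) z).
      by apply: cvgD; [exact: cvg_id|exact: cvg_cst].
    exact: cz.
  have near_in : \forall h \near (0 : R), `|P 0 - z (h + t)| < r / 2.
    have cn : `|P 0 - z (h + t)| @[h --> (0 : R)] --> `|P 0 - z t|.
      by apply: cvg_norm; apply: cvgB; [exact: cvg_cst|exact: czt].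
    exact: (cvgr_lt _ cn _ (zr t t01)).
  have near_small : \forall h \near (0 : R), 2 * (`|h| * C) < eta.
    have cn : 2 * (`|h| * C) @[h --> (0 : R)] --> 2 * (`|(0 : R)| * C).
      have nc : `|h| @[h --> (0 : R)] --> `|(0 : R)| by exact: norm_continuous.
      by apply: cvgM (cvg_cst _) _; apply: cvgM nc (cvg_cst _).
    by apply: (cvgr_lt _ cn); rewrite normr0 mul0r mulr0.
  have N : \forall h \near (0 : R), `|0 - h^-1 *: (g (h *: (1 : R) + t) - g t)| <= e.
    apply: filterS2 near_in near_small => h hin hsmall.
    have [->|h0] := eqVneq h 0; first by rewrite invr0 scale0r subrr normr0 ltW.
    rewrite [h *: 1]mulr1 sub0r normrN normrZ normfV ler_pdivrMl ?normr_gt0 //.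
    set b := inv (z (h + t)).
    have br : `|b| <= r by apply/invr/ltW.
    have zh : `|z (h + t) - z t| = `|h| * C.
      by rewrite /z opprD addrACA subrr add0r -scalerBl addrK normrZ.
    have ba : `|b - a| <= 2 * (`|h| * C).
      have := near_identity_inverse_lipschitz br ar.
      by rewrite (Pinv _ (ltW hin)) (Pinv _ ztr) zh.
    have Hb : `|delta b - delta a| <= e' * `|b - a|.
      by apply: Heta; rewrite /= distrC; exact: le_lt_trans ba hsmall.
    have E : delta b - delta a = g (h + t) - g t.
      rewrite -[delta b]/(gamma b - q * P b 0 0) -[delta a]/(gamma a - q * P a 0 0).
      rewrite /b /a (Pinv _ (ltW hin)) (Pinv _ ztr) !z00 /g; ring.
    rewrite -E (le_trans Hb) //; apply: (@le_trans _ _ (e' * (2 * (`|h| * C)))).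
      by rewrite ler_pM2l.
    have -> : e' * (2 * (`|h| * C)) = `|h| * (e' * (2 * C)) by ring.
    apply: ler_wpM2l => //; rewrite /e' mulrAC ler_pdivrMr // ler_wpM2l ?ltW //.
    by rewrite ltrDl.
  exact: cvg_within N.
have [t||t t01 E] := @MVT R g (fun=> 0) 0 1 ltr01.
- by rewrite in_itv /= => /andP[t0 t1]; apply: dg; rewrite !ltW.
- apply: continuous_in_subspaceT => t; rewrite inE /= in_itv /= => /dg[dgt _].
  exact/differentiable_continuous/derivable1_diffP.
move: E; rewrite mul0r => /eqP; rewrite subr_eq0 => /eqP.
have inv_id y' : `|y'| <= r -> `|P 0 - P y'| < r / 2 -> inv (P y') = y'.
  move=> yr' Pyr'; have := near_identity_inverse_lipschitz (invr _ (ltW Pyr')) yr'.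
  rewrite (Pinv _ (ltW Pyr')) subrr normr0 mulr0 normr_le0 subr_eq0 => /eqP; exact.
rewrite /g /z scale1r scale0r addr0 subrKC !inv_id //.
Qed.
End LevelCurves.

(** With zero derivative, small increments of [g] would be at most a quarter of those of the
    variable, which contradicts the estimate with constant 1/2. *)
Lemma derive_near_identity_neq0 (R : realType) (g : R -> R) (s : R) : derivable g s 1 ->
  (\forall b \near s, `|g b - g s - (b - s)| <= 2^-1 * `|b - s|) -> 'D_1 g s != 0.
Proof.
move=> /derivable1_diffP dg H; apply/eqP => Dg.
have Dw w : 'D_w g s = 0.
  have : 'D_(w *: (1 : R)) g s = w *: 'D_1 g s by exact: derive_dirZ.
  by rewrite [w *: 1]mulr1 Dg scaler0.
have e0 : (0 : R) < 4^-1 by rewrite invr_gt0.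
have [d /= d0 Hd] := (nbhs_normP _ _).1 (filterI H (zero_derive_littleo dg Dw e0)).
have [A B] : `|g (s + d / 2) - g s - (s + d / 2 - s)| <= 2^-1 * `|s + d / 2 - s| /\
    `|g (s + d / 2) - g s| <= 4^-1 * `|s + d / 2 - s|.
  apply: Hd; by rewrite /= opprD addNKr normrN gtr0_norm ?divr_gt0 // ltr_pdivrMr // ltr_pMr // ltr1n.
have d2 : 0 < d / 2 by rewrite divr_gt0.
move: A B; rewrite [s + _ - s]addrC addKr (gtr0_norm d2) => A B.
have := ler_normB (g (s + d / 2) - g s) (g (s + d / 2) - g s - d / 2).
rewrite opprB addrC subrK (gtr0_norm d2); lra.
Qed.

(** * A cylindrical neighbourhood of a point *)

Section LocalCylinder.
Variables (R : realType) (F nrm : 'rV[R]_2 -> 'rV[R]_3) (U : set 'rV[R]_2).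
Variables (u0 : 'rV[R]_2) (v : 'rV[R]_3).
Hypothesis oU : open U.
Hypothesis sF : smooth_on U F.
Hypothesis cnrm : forall u, U u -> {for u, continuous nrm}.
Hypothesis nrm1 : forall u, U u -> dotv (nrm u) (nrm u) = 1.
Hypothesis nrmF : forall u w, U u -> dotv (nrm u) ('d F u w) = 0.
Hypothesis nrmv : forall u, U u -> dotv (nrm u) v = 0.
Hypothesis vv : dotv v v = 1.
Hypothesis Uu0 : U u0.
Hypothesis dF_inj : injective ('d F u0).

(** In the orthonormal frame [w], [v], [n] at [u0], the [n] component of the surface depends on its
    [w] component alone, by [level_curve_constant]. Each point therefore lies on the ruling through
    a point of [c], the projection of a straight segment of the parameter domain. *)
Lemma local_cylinder : exists (O : set 'rV[R]_2) (c : R -> 'rV[R]_3) (a b l r : R),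
  [/\ [/\ open O, O `<=` U & O u0],
      smooth_on (`]a, b[%classic : set R) c,
      forall s, a < s < b -> derive1 c s != 0 /\
        exists2 u, U u & c s = orthoproj v (F u)
    & F @` O = cylinder_piece c a b l r v].
Proof.
pose n := nrm u0; have nn : dotv n n = 1 by exact: nrm1.
have nv : dotv n v = 0 by exact: nrmv.
have n0 : n != 0 by rewrite -dotv_eq0 nn oner_neq0.
pose w := cross n v; have [ww wv wn _] := dotv_cross 0 nn vv nv.
have frame y : y = dotv w y *: w + dotv v y *: v + dotv n y *: n.
  by have [_ _ _] := dotv_cross y nn vv nv.
pose a (j : 'I_2) := if j == 0 then w else v.
have na j : dotv n (a j) = 0 by rewrite /a; case: ifP => // _; rewrite dotvC.
have aa j k : dotv (a j) (a k) = (j == k)%:R.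
  case: j k => [[|[|//]] ?] [[|[|//]] ?]; rewrite /a /= ?ww ?wv ?vv //.
  by rewrite dotvC wv.
(* On this set the normal keeps a nonzero component along [n], which is the denominator in
   [Dgamma]. *)
pose U' : set 'rV[R]_2 := [set u | U u /\ dotv n (nrm u) != 0].
have oU' : open U'.
  rewrite openE => u [Uu nu]; apply: filterI; first by apply: open_nbhs_nbhs.
  have cn : dotv n (nrm x) @[x --> u] --> dotv n (nrm u).
    apply: (@continuous_comp _ _ _ nrm (dotv n)); first exact: cnrm.
    exact: linear_rV_continuous.
  exact: (cvgr_neq0 _ cn nu).
have sF' : smooth_on U' F by move=> s u [Uu _]; exact: sF.
have U'u0 : U' u0 by split=> //; rewrite -/n nn oner_neq0.
have nF x : dotv n ('d F u0 x) = 0 by exact: nrmF.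
have [B uB locB] := local_projection oU' sF' U'u0 dF_inj n0 nF na aa.
have r_gt0 : \forall r \near (0 : R)^'+, 0 < r by exact: nbhs_right_gt.
have [r [r0 [inU est onto]]] := filter_ex (filterI r_gt0 locB).
pose G x := F (u0 + x *m B); pose P x := plane_coords a (G x).
have P0E x : P x 0 0 = dotv w (G x) by rewrite mxE.
have P1E x : P x 0 1 = dotv v (G x) by rewrite mxE.
pose L := mulmxr B : {linear 'rV[R]_2 -> 'rV[R]_2}.
have cL : continuous L by exact: linear_rV_continuous.
have dF x : `|x| <= r -> differentiable F (u0 + L x).
  by move=> /inU Ux; exact: smooth_on_differentiable sF' Ux.
have dG x : `|x| <= r -> differentiable G x.
  by move=> xr; apply: (differentiable_affine (L := L)) => //; exact: dF.
have DG x y : `|x| <= r -> 'D_y G x = 'd F (u0 + x *m B) (y *m B).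
  move=> xr; apply: etrans (derive_affine y cL (dF x xr)) _.
  by apply: deriveE; exact: dF.
have ddot q x : `|x| <= r -> differentiable (fun x => dotv q (G x)) x.
  move=> xr; apply: (@differentiable_comp _ _ _ _ G (dotv q)); first exact: dG.
  by apply: linear_differentiable; exact: linear_rV_continuous.
have Ddot q x y : `|x| <= r -> 'D_y (fun x => dotv q (G x)) x = dotv q ('D_y G x).
  move=> xr; apply: derive_linear; [exact: linear_rV_continuous|exact: dG].
have P0fun : (fun x => P x 0 0) = (fun x => dotv w (G x)) by apply/funext => x; rewrite P0E.
pose gamma x := dotv n (G x).
have dP0 x : `|x| <= r -> differentiable (fun x => P x 0 0) x.
  by rewrite P0fun; exact: ddot.
(* A tangent vector is orthogonal to the normal [m], and [m] is orthogonal to [v]; this ties the [n]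
   component of the tangent vector to its [w] component. *)
have Dgamma x : `|x| <= r ->
    exists q, forall y, 'D_y gamma x = q * 'D_y (fun x => P x 0 0) x.
  move=> xr; have [Ux nx] := inU x xr; set m := nrm (u0 + x *m B) in nx.
  exists (- dotv m w / dotv n m) => y; rewrite P0fun !Ddot //.
  have : dotv m ('D_y G x) = 0 by rewrite DG //; exact: nrmF.
  rewrite {1}(frame ('D_y G x)) !dotvDr !dotvZr (nrmv Ux) mulr0 addr0 [dotv m n]dotvC => E.
  apply: (mulIf nx); rewrite mulrAC divfK //; apply/eqP.
  by rewrite -subr_eq0 mulNr opprK addrC mulrC E.
have level := level_curve_constant est onto dP0 (ddot n) Dgamma.
pose line (s : R) : 'rV[R]_2 := s *: 'e_0.
have line_norm s : `|line s| <= `|s|.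
  apply: rV_norm_le => // i; rewrite !mxE normrM ler_piMr //.
  by case: (_ && _); rewrite ?normr1 ?normr0.
(* For [|s| <= e] the point [P (line s)] is within 3/2 of [r / 4] from [P 0], hence strictly within
   [r / 2]. *)
pose e := r / 4; have e0 : 0 < e by rewrite divr_gt0.
have er s : `|s| <= e -> `|s| <= r.
  by move=> se; apply: (le_trans se); rewrite /e ler_pdivrMr // ler_pMr // ler1n.
have line_r s : `|s| <= e -> `|line s| <= r.
  by move=> /er; apply: le_trans.
pose kap s := P (line s) 0 0.
have kap_est s t : `|s| <= e -> `|t| <= e ->
    `|kap s - kap t - (s - t)| <= 2^-1 * `|s - t|.
  move=> se te; have := est _ _ (line_r s se) (line_r t te).
  rewrite -scalerBl => E; have := le_trans (rV_coord_le _ 0) E.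
  have -> : (P (line s) - P (line t) - (s - t) *: 'e_0) 0 0 = kap s - kap t - (s - t).
    by rewrite !mxE /kap eqxx mulr1 !P0E.
  by move=> /le_trans; apply; apply: ler_wpM2l => //; exact: line_norm.
have kap_incr s t : `|s| <= e -> `|t| <= e -> s < t -> kap s < kap t.
  move=> se te st; have d : 0 < t - s by rewrite subr_gt0.
  have := kap_est t s te se; rewrite (gtr0_norm d) ler_norml => /andP[+ _].
  by move: (kap t) (kap s) => x y; lra.
have center s : `|s| <= e -> `|P 0 - P (line s)| < r / 2.
  move=> se; have r00 : `|(0 : 'rV[R]_2)| <= r by rewrite normr0 ltW.
  have := est 0 (line s) r00 (line_r s se); rewrite sub0r opprK normrN => E.
  have := ler_normB (P 0 - P (line s) + line s) (line s); rewrite addrK.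
  have := line_norm s; move: se; rewrite /e; move: E.
  rewrite -[X in `|X + _|]/(P 0 - P (line s)).
  by move: `|_ + line s| `|line s| `|s| `|P 0 - _| => p q t k; lra.
pose l := P 0 0 1 - r / 2; pose l' := P 0 0 1 + r / 2.
(* The norm is the sup norm, so bounding the two coordinates separately suffices. *)
have near_center (z : 'rV[R]_2) s : `|s| <= e -> z 0 0 = kap s -> l < z 0 1 < l' ->
    `|P 0 - z| < r / 2.
  move=> se z0 /andP[lz zl].
  have z1 : `|P 0 0 1 - z 0 1| < r / 2.
    by rewrite ltr_norml; move: lz zl; rewrite /l /l'; lra.
  apply: (@le_lt_trans _ _ (Num.max `|P 0 - P (line s)| `|P 0 0 1 - z 0 1|)); last first.
    by rewrite gt_max center.
  apply: rV_norm_le => [|i]; first by rewrite le_max normr_ge0.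
  case: i => [[|[|//]] lti].
    have -> : Ordinal lti = 0 by apply: val_inj.
    rewrite le_max; apply/orP; left.
    have -> : (P 0 - z) 0 0 = (P 0 - P (line s)) 0 0 by rewrite !mxE z0 /kap P0E.
    exact: rV_coord_le.
  have -> : Ordinal lti = 1 by apply: val_inj.
  by rewrite le_max; apply/orP; right; rewrite !mxE.
pose c s := orthoproj v (G (line s)).
have projE y : orthoproj v y = dotv w y *: w + dotv n y *: n.
  by rewrite /orthoproj {1}(frame y) addrAC addrK.
(* [x] and [line s] lie on the same level curve, so their images differ only along [v]. *)
have key x s : `|x| <= r -> `|s| <= e -> P x 0 0 = kap s -> l < P x 0 1 < l' ->
    G x = c s + P x 0 1 *: v.
  move=> xr se xs xl; have gx : gamma x = gamma (line s).
    apply: level => //; [exact: line_r|exact: near_center xs xl|exact: center].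
  rewrite /c projE -/(gamma (line s)) -gx -P0E -/(kap s) -xs {1}(frame (G x)).
  by rewrite -P0E -P1E -/(gamma x) addrAC.
have cG x j : `|x| <= r -> {for x, continuous (fun x => P x 0 j)}.
  move=> xr; have -> : (fun x => P x 0 j) = (fun x => dotv (a j) (G x)).
    by apply/funext => y; rewrite mxE.
  exact/differentiable_continuous/ddot.
pose V : set 'rV[R]_2 := [set x | [/\ `|x| < r, kap (- e) < P x 0 0 < kap e & l < P x 0 1 < l']].
have oV : open V.
  rewrite openE => x [xr /andP[x0 x0'] /andP[x1 x1']].
  have c0 := cG x 0 (ltW xr); have c1 := cG x 1 (ltW xr).
  have N0 : \forall y \near x, `|y| < r by exact: (cvgr_lt _ (@norm_continuous _ _ x) _ xr).
  have N1 : \forall y \near x, kap (- e) < P y 0 0 by exact: (cvgr_gt _ c0 _ x0).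
  have N2 : \forall y \near x, P y 0 0 < kap e by exact: (cvgr_lt _ c0 _ x0').
  have N3 : \forall y \near x, l < P y 0 1 by exact: (cvgr_gt _ c1 _ x1).
  have N4 : \forall y \near x, P y 0 1 < l' by exact: (cvgr_lt _ c1 _ x1').
  apply: filterS3 N0 (filterI N1 N2) (filterI N3 N4) => y y0 [y1 y2] [y3 y4].
  by split=> //; apply/andP.
have e_le : `|e| <= e by rewrite gtr0_norm.
have Ne_le : `|- e| <= e by rewrite normrN.
have in_le s : - e < s < e -> `|s| <= e.
  by move=> /andP[s1 s2]; rewrite ler_norml !ltW.
(* The intermediate value theorem finds the point of the directrix below a given surface point. *)
have ivt sigma : kap (- e) < sigma < kap e -> exists2 s, - e < s < e & kap s = sigma.
  move=> /andP[s1 s2]; have ee : - e <= e by rewrite ge0_cp // ltW.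
  have ck : {within `[- e, e], continuous kap}.
    apply: continuous_in_subspaceT => s; rewrite inE /= in_itv /= -ler_norml => se.
    apply: (@continuous_comp _ _ _ line (fun x => P x 0 0)); first exact: scalel_continuous.
    exact/cG/line_r.
  have [|s] := IVT ee ck (v := sigma).
    by rewrite ge_min le_max !(ltW s1, ltW s2) ?orbT.
  rewrite in_itv /= => /andP[s3 s4] ks; exists s => //; rewrite !lt_neqAle s3 s4 !andbT.
  apply/andP; split; apply/eqP => E.
    by move: s1; rewrite -ks -E ltxx.
  by move: s2; rewrite -ks E ltxx.
pose O : set 'rV[R]_2 := [set u | V ((u - u0) *m invmx B)].
have O_of x : V x -> O (u0 + x *m B).
  by move=> Vx; rewrite /O /= [u0 + _]addrC addrK mulmxK.
have of_O u : O u -> u = u0 + ((u - u0) *m invmx B) *m B.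
  by move=> _; rewrite mulmxKV // addrC subrK.
have sc0 : smooth_on [set s : R | U' (u0 + s *: ('e_0 *m B))] c.
  have -> : c = orthoproj v \o (fun s : R => F (u0 + s *: ('e_0 *m B))).
    by apply/funext => s; rewrite /c /G /line -scalemxAl.
  apply: smooth_on_linear; first exact: linear_rV_continuous.
    have ca : continuous (fun s : R => u0 + s *: ('e_0 *m B)).
      by move=> s; apply: cvgD; [exact: cvg_cst|exact: scalel_continuous].
    by apply: open_comp oU' => s _; exact: ca.
  exact: smooth_on_line.
have sc : smooth_on (`]- e, e[%classic : set R) c.
  move=> ws s /=; rewrite in_itv /= => /in_le se; apply: sc0 => /=.
  by rewrite scalemxAl; apply: inU; exact: line_r.
exists O, c, (- e), e, l, l'; split.
- split.
  + have ci : continuous (fun u : 'rV[R]_2 => (u - u0) *m invmx B).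
      pose L' := mulmxr (invmx B) : {linear 'rV[R]_2 -> 'rV[R]_2}.
      have cL' : continuous L' by exact: linear_rV_continuous.
      have -> : (fun u : 'rV[R]_2 => (u - u0) *m invmx B) = (fun u => L' u - L' u0).
        by apply/funext => u; rewrite -linearB.
       by move=> u; have cu := cL' u; apply: cvgB cu _; exact: cvg_cst.
    by apply: open_comp oV => u _; exact: ci.
  + by move=> u Ou; rewrite (of_O u Ou); have [/ltW/inU[]] := Ou.
  + have V0 : V 0.
      have l0 : line 0 = 0 by rewrite /line scale0r.
      have e00 : `|0 : R| <= e by rewrite normr0 ltW.
      split; [by rewrite normr0| |rewrite /l /l'].
        rewrite -{1 2}l0 -/(kap 0); apply/andP; split; apply: kap_incr => //.
        by rewrite oppr_lt0.
      by have : 0 < r / 2 by [exact: divr_gt0]; move: (P 0 0 1) => p rr; apply/andP; split; lra.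
    by rewrite /O /= subrr mul0mx.
- exact: sc.
- move=> s se; have sle := in_le s se; split; last first.
    by exists (u0 + line s *m B) => //; have [] := inU _ (line_r s sle).
  have dc : differentiable c s.
    by apply: smooth_on_differentiable sc _; rewrite /= in_itv.
  (* Regularity of [c] follows from that of [kap], its component along [w]. *)
  have kE : kap = dotv w \o c.
    by apply/funext => t /=; rewrite /c /orthoproj dotvBr dotvZr wv mulr0 subr0 -P0E.
  have cw : continuous (dotv w) by exact: linear_rV_continuous.
  have dk : derivable kap s 1.
    rewrite kE; apply/diff_derivable/(@differentiable_comp _ _ _ _ c (dotv w)) => //.
    exact/linear_differentiable/cw.
  have near_s : \forall t \near s, `|kap t - kap s - (t - s)| <= 2^-1 * `|t - s|.
    move: se => /andP[s1 s2].
    apply: filterS2 (lt_nbhsr s1) (lt_nbhsl s2) => t t1 t2.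
    by apply: kap_est => //; apply: in_le; rewrite t1 t2.
  apply: contraNneq (derive_near_identity_neq0 dk near_s); rewrite derive1E => Dc.
  by rewrite kE derive_linear // Dc linear0.
- rewrite eqEsubset; split=> [_ [u Ou <-]|_ [s [t [se tl ->]]]].
    have [xr x0 xl] := Ou; have [s se ks] := ivt _ x0.
    exists s, (P ((u - u0) *m invmx B) 0 1); split=> //.
    by rewrite {1}(of_O u Ou); apply: key => //; [exact: ltW|exact: in_le].
  pose z : 'rV[R]_2 := \row_j (if j == 0 then kap s else t).
  have z0 : z 0 0 = kap s by rewrite mxE.
  have z1 : z 0 1 = t by rewrite mxE.
  have sle := in_le s se.
  have Pz : `|P 0 - z| < r / 2 by apply: near_center sle z0 _; rewrite z1.
  have [x xr xz] := onto z (ltW Pz).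
  have r00 : `|(0 : 'rV[R]_2)| <= r by rewrite normr0 ltW.
  (* [onto] only gives the closed ball; the inverse Lipschitz bound and the strict inequality for
     [z] put [x] in the open one. *)
  have xr' : `|x| < r.
    have := near_identity_inverse_lipschitz est xr r00.
    rewrite subr0 => /le_lt_trans; apply.
    have -> : plane_coords a (F (u0 + x *m B)) = z by exact: xz.
    by rewrite distrC -ltr_pdivlMl // mulrC.
  have Vx : V x.
    rewrite /V /= /P /G xz z0 z1; split=> //; move: se => /andP[s1 s2].
    by rewrite !kap_incr.
  exists (u0 + x *m B); first exact: O_of.
  rewrite -[LHS]/(G x) (key x s) //; rewrite /P /G xz ?z0 ?z1 //.
Qed.
End LocalCylinder.

(** * Classification *)

Lemma orthoproj_sqr (R : realType) n (a v : 'rV[R]_n) : dotv v v = 1 ->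
  dotv (orthoproj v a) (orthoproj v a) = dotv a a - dotv a v ^+ 2.
Proof.
move=> vv; have v0 : dotv v (orthoproj v a) = 0 by rewrite dotvBr dotvZr vv mulr1 subrr.
rewrite {2}/orthoproj dotvBr dotvZr [dotv _ v]dotvC v0 mulr0 subr0 dotvC.
by rewrite /orthoproj dotvBr dotvZr [dotv v a]dotvC.
Qed.

Section Assembly.
Variables (R : realType) (Sigma : smooth_surface R).
Variables (f N : Sigma -> 'rV[R]_3) (v : 'rV[R]_3).
Hypothesis f_imm : immersion f.
Hypothesis N_normal : gauss_map f N.
Hypothesis vv : dotv v v = 1.

(** [C] is the projection of the whole surface to the plane through 0 orthogonal to [v]; it is
    connected as a continuous image, and [local_cylinder] supplies the arcs. *)
Lemma tangent_direction_cylindrical : (forall p, dotv (N p) v = 0) -> is_cylindrical f v.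
Proof.
move=> Nv; have [sf inj_f] := f_imm; have [sN N1 Nf] := N_normal.
have cf := smooth_map_continuous sf; have cN := smooth_map_continuous sN.
exists (range (orthoproj v \o f)); split.
- apply: connected_continuous_connected; first exact: surf_connected.
  apply: continuous_subspaceT => p; apply: continuous_comp; first exact: cf.
  exact: linear_rV_continuous.
- by exists 0 => _ [p _ <-]; rewrite dotvC /orthoproj /= dotvBr dotvZr vv mulr1 subrr.
- move=> p; exists (orthoproj v (f p)), (dotv v (f p)).
  by split; [exists p|rewrite /orthoproj subrK].
- by move=> _ [p _ <-]; exists p, (dotv v (f p)); rewrite /= /orthoproj subrK.
- move=> p; have [i [u iu <-]] := chart_cover p.
  have cn u' : pdom i u' -> {for u', continuous (N \o param i)}.
    by move=> iu'; exact/differentiable_continuous/(smooth_on_differentiable (sN i) iu').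
  have [D [c [a [b [l [r [[oD DU Du] sc cC imD]]]]]]] :=
    local_cylinder (@pdom_open _ _ i) (sf i) cn (fun u _ => N1 (param i u))
      (fun u w iu => Nf i u iu w) (fun u _ => Nv (param i u)) vv iu (inj_f i u iu).
  exists (param i @` D), c, a, b, l, r; split=> //.
  + by split; [exact: open_param|exists u].
  + move=> s /cC[? [u' iu' ->]]; split=> //; by exists (param i u').
  + by rewrite -imD image_comp.
Qed.

Lemma dotv_sqr_le1 p : dotv (N p) v ^+ 2 <= 1.
Proof.
have [_ N1 _] := N_normal.
by rewrite -subr_ge0 -(N1 p) -(orthoproj_sqr _ vv) dotv_ge0.
Qed.

(** Equality case of Cauchy-Schwarz: the projection of [N p] orthogonal to [v] has zero length. *)
Lemma dotv_sqr1_parallel p : dotv (N p) v ^+ 2 = 1 -> N p = dotv (N p) v *: v.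
Proof.
have [_ N1 _] := N_normal => E; apply/eqP; rewrite -subr_eq0 -dotv_eq0.
have -> : N p - dotv (N p) v *: v = orthoproj v (N p) by rewrite dotvC.
by rewrite orthoproj_sqr // N1 E subrr.
Qed.

Variables (k1 k2 : Sigma -> R) (lambda c : R).
Hypothesis k12 : principal_curvatures f N k1 k2.
Hypothesis f_soliton : forall p, k1 p * k2 p = dotv (N p) v + lambda.
Hypothesis k1c : forall p, k1 p = c.

Lemma flat_soliton (p0 : Sigma) : c = 0 ->
  [\/ is_planar f, is_cylindrical f v
    | 0 < `|lambda| < 1 /\ exists theta : R,
        [/\ 0 <= theta <= pi, cos theta = `|lambda| & constant_angle f v theta]].
Proof.
move=> c0; have [sN N1 Nf] := N_normal.
have hN p : dotv (N p) v = - lambda.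
  by have /eqP := f_soliton p; rewrite k1c c0 mul0r eq_sym addr_eq0 => /eqP.
have [l0|l0] := eqVneq lambda 0.
  by apply: Or32; apply: tangent_direction_cylindrical => p; rewrite hN l0 oppr0.
have l1 : `|lambda| <= 1.
  by have := dotv_sqr_le1 p0; rewrite hN sqrrN -real_normK ?num_real // expr_le1.
have [l1E|l1N] := eqVneq `|lambda| 1.
  apply: Or31; apply: (constant_normal_planar (p0 := p0) f_imm N_normal) => p.
  have s1 q : dotv (N q) v ^+ 2 = 1.
    by rewrite hN sqrrN -real_normK ?num_real // l1E expr1n.
  by rewrite [LHS](dotv_sqr1_parallel (s1 p)) [RHS](dotv_sqr1_parallel (s1 p0)) !hN.
apply: Or33; split; first by rewrite normr_gt0 l0 lt_neqAle l1N l1.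
have lin : `|lambda| \in `[-1, 1].
  by rewrite in_itv /= l1 (le_trans _ (normr_ge0 _)) // lerN10.
exists (acos `|lambda|); split; [by rewrite acos_ge0 ?acos_lepi// | exact: acosK|].
(* As <N, v> = - lambda, this sign orients the normal so that its product with [v] is [|lambda|]. *)
pose s : R := if lambda <= 0 then 1 else -1.
have ss : s * s = 1 by rewrite /s; case: ifP => _; rewrite ?mulrNN mulr1.
have GN : gauss_map f (fun p => s *: N p).
  split=> [i|p|i u iu w].
  - apply: (smooth_on_linear (L := *:%R s) (f := N \o param i)) (sN i).
      exact: linear_rV_continuous.
    exact: pdom_open.
  - by rewrite dotvZl dotvZr mulrA ss mul1r N1.
  - by rewrite dotvZl Nf // mulr0.
exists (fun p => s *: N p) => // p; rewrite /angle /enorm vv.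
have [_ -> _] := GN; rewrite sqrtr1 mulr1 invr1 mulr1 dotvZl hN; congr (acos _).
rewrite /s; case: ifP => [ln|/negbT]; first by rewrite mul1r ler0_norm.
by rewrite -ltNge => lp; rewrite mulrNN mul1r gtr0_norm.
Qed.

(** * Constant nonzero principal curvature *)

Let x (i : chart Sigma) (j : 'I_3) (u : 'rV[R]_2) : R := f (param i u) 0 j.
Let n (i : chart Sigma) (j : 'I_3) (u : 'rV[R]_2) : R := N (param i u) 0 j.

Let smooth_coord (g : Sigma -> 'rV[R]_3) i (j : 'I_3) : smooth_map g ->
  smooth_on (pdom i) (fun u => g (param i u) 0 j).
Proof.
move=> sg; have := smooth_map_linear (i := i) (dotv 'e_j) sg.
by congr (smooth_on _ _); apply/funext => u /=; rewrite dotv_delta.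
Qed.

Let derive_coord (g : Sigma -> 'rV[R]_3) i (j : 'I_3) u w : smooth_map g -> pdom i u ->
  'D_w (fun u => g (param i u) 0 j) u = ('d (g \o param i) u w) 0 j.
Proof.
move=> sg iu; have dg := smooth_on_differentiable (sg i) iu.
by rewrite -deriveE // derive_mx ?mxE //; exact: diff_derivable.
Qed.

Lemma nonflat_focal i u w j : c != 0 -> pdom i u ->
  'D_w (x i j + c^-1 *: n i j) u != 0 -> dotv (N (param i u)) v = 0 /\ lambda = 0.
Proof.
have [sf inj_f] := f_imm; have [sN N1 Nf] := N_normal.
move=> c0 iu; rewrite dotv3E.
apply: (@focal_chart R (pdom i) (x i) (n i) v (k2 \o param i) c lambda) => //.
- exact: pdom_open.
- by move=> j'; exact: smooth_coord.
- by move=> j'; exact: smooth_coord.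
- by move=> u' iu'; rewrite -(N1 (param i u')) dotv3E.
- by move=> u' w' iu'; rewrite -(Nf i u' iu' w') dotv3E !derive_coord.
- move=> u' w' iu' dx0; apply: (inj_f i u' iu'); rewrite linear0.
  by apply/rowP => j'; rewrite -derive_coord // [LHS]dx0 mxE.
- move=> u' iu'; have [A hA cA] := k12 iu'; exists A; last by rewrite cA k1c.
  move=> w' j'; apply: etrans (derive_coord j' _ sf iu') _.
  by rewrite hA mxE; congr (- _); apply/esym/(derive_coord j' w' sN iu').
- by move=> u' iu'; rewrite -(k1c (param i u')) f_soliton dotv3E.
Qed.

Let derive_focal i j u w : pdom i u -> 'D_w (x i j + c^-1 *: n i j) u
  = ('d (f \o param i) u w) 0 j + c^-1 * ('d (N \o param i) u w) 0 j.
Proof.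
have [sf _] := f_imm; have [sN _ _] := N_normal => iu.
have dx : derivable (x i j) u w.
  by apply: diff_derivable; exact: smooth_on_differentiable (smooth_coord j sf) iu.
have dn : derivable (n i j) u w.
  by apply: diff_derivable; exact: smooth_on_differentiable (smooth_coord j sN) iu.
rewrite deriveD //; last exact: derivableZ.
by rewrite deriveZ //; congr (_ + _ * _); exact: derive_coord.
Qed.

(** The other principal curvature is zero here, and in its direction dN vanishes, so the focal
    differential equals dx, which is nonzero. *)
Lemma flat_focal i u : c != 0 -> pdom i u -> k1 (param i u) * k2 (param i u) = 0 ->
  exists w j, 'D_w (x i j + c^-1 *: n i j) u != 0.
Proof.
have [sf inj_f] := f_imm => c0 iu /eqP; rewrite k1c mulf_eq0 (negPf c0) => /eqP k20.
have [A hA cA] := k12 iu.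
have /eigenvalueP[w wA w0] : eigenvalue A 0.
  by rewrite eigenvalue_root_char cA k20 rootM !root_XsubC eqxx orbT.
have dNw : 'd (N \o param i) u w = 0.
  by apply/eqP; rewrite -oppr_eq0 -hA wA scale0r linear0.
have : 'd (f \o param i) u w != 0.
  by apply: contraNneq w0 => dw; apply/eqP/(inj_f i u iu); rewrite linear0.
move=> dw; have [j dwj] : exists j, ('d (f \o param i) u w) 0 j != 0.
  apply/existsP; apply: contraNT dw; rewrite negb_exists => /forallP d0.
  by apply/eqP/rowP => j; have := d0 j; rewrite negbK mxE => /eqP.
have b0 : ('d (N \o param i) u w) 0 j = 0 by rewrite dNw mxE.
have neq (a b k d : R) : d = a + k * b -> b = 0 -> a != 0 -> d != 0.
  by move=> -> ->; rewrite mulr0 addr0.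
by exists w, j; exact: neq (derive_focal j w iu) b0 dwj.
Qed.

(** A vanishing focal differential makes every point umbilic, dN = - c dx, so the other curvature is
    [c] and <N, v> is constant. Differentiating this makes [v] normal to the surface, so N is
    constant and dx = 0, against immersion. *)
Lemma focal_point_absurd (p0 : Sigma) : c != 0 ->
  (forall i j u w, pdom i u -> 'D_w (x i j + c^-1 *: n i j) u = 0) -> False.
Proof.
have [sf inj_f] := f_imm; have [sN N1 Nf] := N_normal => c0 dy0.
have dN i u w : pdom i u -> 'd (N \o param i) u w = - c *: 'd (f \o param i) u w.
  move=> iu; apply/rowP => j; have := etrans (esym (derive_focal j w iu)) (dy0 i j u w iu).
  move=> /eqP; rewrite addrC addr_eq0 => /eqP E; rewrite mxE; apply: (mulfI (invr_neq0 c0)).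
  by rewrite E mulNr mulrN mulKf.
have hc p : dotv (N p) v = c ^+ 2 - lambda.
  have [i [u iu <-]] := chart_cover p.
  have [A hA cA] := k12 iu.
  have /eigenvalueP[w wA w0] : eigenvalue A (k2 (param i u)).
    by rewrite eigenvalue_root_char cA rootM !root_XsubC eqxx orbT.
  have k2c : k2 (param i u) = c.
    have : (k2 (param i u) - c) *: w = 0.
      suff wc : w *m A = c *: w by rewrite scalerBl -wA wc subrr.
      apply: (inj_f i u iu); apply: etrans (hA w) _.
      apply: etrans (congr1 -%R (dN i u w iu)) _.
      by rewrite scaleNr opprK [RHS]linearZ.
    by move/eqP; rewrite scaler_eq0 (negPf w0) orbF subr_eq0 => /eqP.
  by apply/eqP; rewrite eq_sym subr_eq -f_soliton k1c k2c.
have vN p : N p = dotv (N p) v *: v.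
  have [i [u iu <-]] := chart_cover p; set m := N (param i u).
  have mm : dotv m m = 1 by exact: N1.
  have vF w : dotv v ('d (f \o param i) u w) = 0.
    have D : 'D_w (dotv v \o (N \o param i)) u = 0.
      rewrite (@derive_eq_on _ _ _ (pdom i) _ (cst (c ^+ 2 - lambda))) ?derive_cst //.
        exact: pdom_open.
      by move=> u' _ /=; rewrite dotvC hc.
    have cv : continuous (dotv v) by exact: linear_rV_continuous.
    have dn := smooth_on_differentiable (sN i) iu.
    have E := etrans (esym (derive_linear w cv dn)) D.
    have E2 := etrans (deriveE w dn) (dN i u w iu).
    move: E; rewrite -[X in X = _]/(dotv v _) E2 dotvZr => /eqP.
    by rewrite mulf_eq0 oppr_eq0 (negPf c0) => /eqP.
  have m0 : m != 0 by rewrite -dotv_eq0 mm oner_neq0.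
  have mr : dotv m (orthoproj m v) = 0 by rewrite dotvBr dotvZr mm mulr1 subrr.
  have [w wE] := tangent_plane m0 (inj_f i u iu) (fun w => Nf i u iu w) mr.
  (* The tangential part of [v] is the image of some [w], to which [v] is orthogonal; hence it is
     orthogonal to itself. *)
  have r0 : orthoproj m v = 0.
    apply/eqP; rewrite -dotv_eq0 {2}/orthoproj dotvBr dotvZr [dotv _ m]dotvC mr mulr0 subr0.
    by rewrite dotvC -wE vF.
  have vm : v = dotv m v *: m by apply/eqP; rewrite -subr_eq0; apply/eqP; exact: r0.
  have sq : dotv m v * dotv m v = 1.
    by have := congr1 (dotv v) vm; rewrite vv dotvZr [dotv v m]dotvC => <-.
  by rewrite {2}vm scalerA sq scale1r.
have [i [u iu _]] := chart_cover p0.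
have : 'd (f \o param i) u 'e_0 = 0.
  have : 'd (N \o param i) u 'e_0 = 0.
    rewrite -deriveE; last exact: smooth_on_differentiable (sN i) iu.
    have -> : N \o param i = cst ((c ^+ 2 - lambda) *: v).
      by apply/funext => u' /=; rewrite vN hc.
    exact: derive_cst.
  move=> N0; have /eqP := etrans (esym (dN i u 'e_0 iu)) N0.
  by rewrite scaler_eq0 oppr_eq0 (negPf c0) => /eqP.
rewrite -(linear0 ('d (f \o param i) u)) => /(inj_f i u iu)/rowP/(_ 0).
by rewrite !mxE eqxx => /eqP; rewrite oner_eq0.
Qed.

Lemma nonflat_soliton (p0 : Sigma) : c != 0 -> forall p, dotv (N p) v = 0.
Proof.
move=> c0; have [sN N1 Nf] := N_normal.
have [[p1 [Np1 l0]]|no] := pselect (exists p, dotv (N p) v = 0 /\ lambda = 0).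
  move=> p; apply: (surface_connected (P := fun p => dotv (N p) v = 0)) Np1 => q.
    (* Openness: K = 0 at [q], so the focal differential is nonzero there and, by continuity,
       nearby, where [nonflat_focal] applies. *)
    have [i [u iu <-]] := chart_cover q => Nq.
    have [w [j dw]] : exists w j, 'D_w (x i j + c^-1 *: n i j) u != 0.
      by apply: flat_focal => //; rewrite f_soliton Nq l0 addr0.
    have cy : {for u, continuous ('D_w (x i j + c^-1 *: n i j))}.
      apply: (@smooth_on_derive_continuous _ _ _ (pdom i)) => //.
      apply: smooth_onDZ; [exact: pdom_open| |exact: smooth_coord].
      by apply: smooth_coord; have [] := f_imm.
    have near_u : \forall u' \near u, 'D_w (x i j + c^-1 *: n i j) u' != 0.
      exact: (cvgr_neq0 _ cy dw).
    apply: filterS (nbhs_param iu near_u) => _ [u' [iu' dw'] <-].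
    by have [] := nonflat_focal c0 iu' dw'.
  move=> /eqP Nq; have cq : dotv v (N x) @[x --> q] --> dotv v (N q).
    apply: (@continuous_comp _ _ _ N (dotv v)); first exact: smooth_map_continuous.
    exact: linear_rV_continuous.
  have vNq : dotv v (N q) != 0 by rewrite dotvC.
  have near_q : \forall q' \near q, dotv v (N q') != 0 by exact: (cvgr_neq0 _ cq vNq).
  by apply: filterS near_q => q' /eqP; rewrite dotvC.
(* Without such a point, [nonflat_focal] leaves no point with nonzero focal differential. *)
exfalso; apply: (focal_point_absurd p0 c0) => i j u w iu.
apply/eqP; apply: contrapT => /negP dw; apply: no.
by exists (param i u); exact: nonflat_focal c0 iu dw.
Qed.

Lemma soliton_classification :
  [\/ is_planar f, is_cylindrical f v
    | [/\ forall p, k1 p * k2 p = 0,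
          0 < `|lambda| < 1
        & exists theta : R, [/\ 0 <= theta <= pi, cos theta = `|lambda|
                              & constant_angle f v theta]]].
Proof.
(* An empty surface counts as an empty open piece of an arbitrary plane. *)
have [[p0 _]|empty] := pselect (exists p : Sigma, True); last first.
  apply: Or31; exists 0, (const_mx 1), set0; split.
  - by apply/eqP => /rowP/(_ 0); rewrite !mxE => /eqP; rewrite oner_eq0.
  - exact: open0.
  - by rewrite setI0 -subset0 => y [p _ _]; apply: empty; exists p.
have [c0|c0] := eqVneq c 0; last first.
  by apply: Or32; apply: tangent_direction_cylindrical; exact: nonflat_soliton.
have [P|C|[l01 th]] := flat_soliton p0 c0; [exact: Or31|exact: Or32|apply: Or33].
by split=> // p; rewrite k1c c0 mul0r.
Qed.

End Assembly.

Unset Implicit Arguments.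

Theorem theorem3p2 (R : realType) (Sigma : smooth_surface R)
    (f N : Sigma -> 'rV[R]_3) (k1 k2 : Sigma -> R) (lambda : R) (v : 'rV[R]_3)
    (f_imm : immersion f)
    (N_normal : gauss_map f N)
    (k12 : principal_curvatures f N k1 k2)
    (v_unit : enorm v = 1)
    (f_soliton : translating_soliton N (fun p => k1 p * k2 p) lambda v)
    (k_const : constant_function k1 \/ constant_function k2) :
  [\/ is_planar f,
      is_cylindrical f v
    | [/\ forall p, k1 p * k2 p = 0,
          0 < `|lambda| < 1
        & exists theta : R, [/\ 0 <= theta <= pi, cos theta = `|lambda|
                              & constant_angle f v theta]]].
Proof.
have vv : dotv v v = 1 by rewrite -[LHS]sqr_sqrtr ?dotv_ge0 // -/(enorm v) v_unit expr1n.
case: k_const => -[c kc].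
  exact: (soliton_classification f_imm N_normal vv k12 f_soliton kc).
(* The two eigenvalues enter symmetrically, so the second case reduces to the first by exchanging
   them. *)
have k21 : principal_curvatures f N k2 k1.
  by move=> i u iu; have [A hA cA] := k12 i u iu; exists A => //; rewrite cA mulrC.
have sol p : k2 p * k1 p = dotv (N p) v + lambda by rewrite mulrC; exact: f_soliton.
have [?|?|[K0 l01 th]] := soliton_classification f_imm N_normal vv k21 sol kc.
- exact: Or31.
- exact: Or32.
- by apply: Or33; split=> // p; rewrite mulrC.
Qed.
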